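(* Let $I$ be an index set, $S,T\in GL(2,\mathbb C)$, and for $r\in I$ let $P_r=S\,\mathrm{diag}\{p_{1r},p_{2r}\}S^{-1}$, $Q_r=T\,\mathrm{diag}\{q_{1r},q_{2r}\}T^{-1}$ (all entries nonzero). There exists a homeomorphism $f\colon\mathbb CP^1\to\mathbb CP^1$ with $f(P_rv)=Q_rf(v)$ for all $v\in\mathbb CP^1$, $r\in I$, if and only if there exists a complex number $\alpha$ with $\operatorname{Re}\alpha\neq-1$ such that either $$\frac{q_{1r}}{q_{2r}}=\frac{p_{1r}}{p_{2r}}\Bigl|\frac{p_{1r}}{p_{2r}}\Bigr|^{\alpha}\ \text{for all }r\in I,\qquad\text{or}\qquad \frac{q_{1r}}{q_{2r}}=\frac{\overline{p_{1r}}}{\overline{p_{2r}}}\Bigl|\frac{p_{1r}}{p_{2r}}\Bigr|^{\alpha}\ \text{for all }r\in I.$$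
   Context: A matrix $P\in GL(n+1,\mathbb C)$ acts on $\mathbb CP^n$ by the induced linear-fractional (projective) transformation $v\mapsto Pv$ in homogeneous coordinates. For $t>0$, $t^\alpha=e^{\alpha\ln t}$. *)

(* Defs.v *)
From Stdlib Require Import Reals Lra.
Open Scope R_scope.

Definition Cpx : Type := (R * R)%type.
Definition Re (z : Cpx) : R := fst z.
Definition Im (z : Cpx) : R := snd z.
Definition RtoC (x : R) : Cpx := (x, 0).
Definition C0 : Cpx := (0, 0).
Definition Cadd (z w : Cpx) : Cpx := (fst z + fst w, snd z + snd w).
Definition Copp (z : Cpx) : Cpx := (- fst z, - snd z).
Definition Csub (z w : Cpx) : Cpx := Cadd z (Copp w).
Definition Cmul (z w : Cpx) : Cpx :=
  (fst z * fst w - snd z * snd w, fst z * snd w + snd z * fst w).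
Definition Cnorm2 (z : Cpx) : R := fst z * fst z + snd z * snd z.
Definition Cinv (z : Cpx) : Cpx := (fst z / Cnorm2 z, - snd z / Cnorm2 z).
Definition Cdiv (z w : Cpx) : Cpx := Cmul z (Cinv w).
Definition Cconj (z : Cpx) : Cpx := (fst z, - snd z).
Definition Cabs (z : Cpx) : R := sqrt (Cnorm2 z).
Definition Cexp (z : Cpx) : Cpx := (exp (fst z) * cos (snd z), exp (fst z) * sin (snd z)).
(* t^alpha := exp(alpha * ln t) for real t > 0 and complex alpha *)
Definition Rcpow (t : R) (alpha : Cpx) : Cpx := Cexp (Cmul alpha (RtoC (ln t))).

Definition Ceq_dec (z w : Cpx) : {z = w} + {z <> w}.
Proof.
  destruct z as [a b], w as [c d].
  destruct (Req_EM_T a c) as [H1|H1]; destruct (Req_EM_T b d) as [H2|H2];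
    try (right; intro H; inversion H; contradiction).
  left; subst; reflexivity.
Defined.

Definition mat2 : Type := ((Cpx * Cpx) * (Cpx * Cpx))%type.
Definition m11 (M : mat2) : Cpx := fst (fst M).
Definition m12 (M : mat2) : Cpx := snd (fst M).
Definition m21 (M : mat2) : Cpx := fst (snd M).
Definition m22 (M : mat2) : Cpx := snd (snd M).
Definition mmul (M N : mat2) : mat2 :=
  ((Cadd (Cmul (m11 M) (m11 N)) (Cmul (m12 M) (m21 N)),
    Cadd (Cmul (m11 M) (m12 N)) (Cmul (m12 M) (m22 N))),
   (Cadd (Cmul (m21 M) (m11 N)) (Cmul (m22 M) (m21 N)),
    Cadd (Cmul (m21 M) (m12 N)) (Cmul (m22 M) (m22 N)))).
Definition mdet (M : mat2) : Cpx :=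
  Csub (Cmul (m11 M) (m22 M)) (Cmul (m12 M) (m21 M)).
(* inverse (meaningful when det M <> 0): adjugate / det *)
Definition minv (M : mat2) : mat2 :=
  let d := mdet M in
  ((Cdiv (m22 M) d, Cdiv (Copp (m12 M)) d),
   (Cdiv (Copp (m21 M)) d, Cdiv (m11 M) d)).
Definition diag2 (x y : Cpx) : mat2 := ((x, C0), (C0, y)).

(* [z : 1] <-> Some z,  [1 : 0] <-> None *)
Definition CP1 : Type := option Cpx.

(* projective action of M on homogeneous coordinates: [u : v] |-> [a u + b v : c u + d v] *)
Definition pact (M : mat2) (x : CP1) : CP1 :=
  match x with
  | Some z =>
      let num := Cadd (Cmul (m11 M) z) (m12 M) in
      let den := Cadd (Cmul (m21 M) z) (m22 M) in
      if Ceq_dec den C0 then None else Some (Cdiv num den)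
  | None => if Ceq_dec (m21 M) C0 then None else Some (Cdiv (m11 M) (m21 M))
  end.

(* chordal metric: induces the standard topology of CP^1 *)
Definition chordal (x y : CP1) : R :=
  match x, y with
  | Some z, Some w => 2 * Cabs (Csub z w) / sqrt ((1 + Cnorm2 z) * (1 + Cnorm2 w))
  | Some z, None | None, Some z => 2 / sqrt (1 + Cnorm2 z)
  | None, None => 0
  end.

Definition continuous_CP1 (f : CP1 -> CP1) : Prop :=
  forall x eps, 0 < eps -> exists delta, 0 < delta /\
    forall y, chordal x y < delta -> chordal (f x) (f y) < eps.

Definition homeomorphism_CP1 (f : CP1 -> CP1) : Prop :=
  exists g : CP1 -> CP1,
    (forall x, g (f x) = x) /\ (forall y, f (g y) = y) /\
    continuous_CP1 f /\ continuous_CP1 g.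

(* Main.v *)
From Stdlib Require Import Reals ZArith Lra Lia Classical ClassicalEpsilon.
From Coquelicot Require Import Rcomplements Hierarchy Continuity.
Require Import Defs.
Open Scope R_scope.

(** Passing to the diagonal normal forms, [f] intertwines multiplications by
    [l = p1 / p2] and [m = q1 / q2].  If some [l] differs from 1, then [f] preserves
    the pair of fixed points 0 and infinity, so it restricts to a homeomorphism of the
    punctured plane and lifts through the exponential to a continuous map [F] of the plane
    with [F (z + u) = F z + d] whenever [exp u = l], where [exp d = m].  Since [F] is
    bounded on bounded sets, [d] depends R-linearly on [u]; the lift of the inverse shows
    that [2 pi i] goes to [+- 2 pi i] and that the linear map is invertible.  Hence
    [d = (a x, b x +- y)] for [u = (x, y)], with [a <> 0], and [alpha = (a - 1) + i b].
    Conversely [z |-> z |z|^alpha], composed if necessary with conjugation and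
    inversion, is the required homeomorphism. *)

(** The translations [u] with [exp u = l r] may form a dense subgroup, and [F] is only continuous,
    so linearity of [u |-> d] cannot be read off from derivatives or from a lattice basis. It has to
    come from the growth of [F] along integer combinations. A single lift [F] serves all [r], which
    is why one [alpha] works for the whole family. The translation by [2 pi i] is always available,
    being a logarithm of 1; sending it to [+- 2 pi i] fixes the second column of the real 2 by 2
    matrix. The sign there separates the two alternatives of the theorem, and the remaining column
    [(a, b)] is [alpha]. Nonvanishing of [a] is exactly [Re alpha <> -1]. Two degenerate families
    need a choice instead of a computation: if all [l r] are 1 there is no pair of fixed points to
    remove, and if all [l r] lie on the unit circle the column [(a, b)] is undetermined. *)

(** * Complex arithmetic, modulus and exponential *)

Definition C1 : Cpx := (1, 0).

Lemma Cpx_ext (z w : Cpx) : fst z = fst w -> snd z = snd w -> z = w.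
Proof. destruct z, w; simpl; intros -> ->; reflexivity. Qed.

Lemma Cnorm2_ge0 (z : Cpx) : 0 <= Cnorm2 z.
Proof. unfold Cnorm2; nra. Qed.

Lemma Cnorm2_gt0 (z : Cpx) : z <> C0 -> 0 < Cnorm2 z.
Proof.
  intros h; destruct (Rle_lt_or_eq_dec _ _ (Cnorm2_ge0 z)) as [H|H]; [exact H|].
  exfalso; apply h; unfold Cnorm2 in H; apply Cpx_ext; simpl; nra.
Qed.

Lemma Cpx_field_theory :
  field_theory C0 C1 Cadd Cmul Csub Copp Cdiv Cinv (@eq Cpx).
Proof.
  split; [split| | |].
  all: try (intros; apply Cpx_ext; unfold Cadd, Cmul, Csub, Copp, C0, C1; simpl; ring).
  - intros H; injection H; lra.
  - intros z h; pose proof (Cnorm2_gt0 z h) as H; unfold Cnorm2 in H.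
    apply Cpx_ext; unfold Cmul, Cinv, Cnorm2; simpl; field; lra.
Qed.

Add Field Cpx_field : Cpx_field_theory.

Lemma C1_neq0 : C1 <> C0.
Proof. intros H; injection H; lra. Qed.

Lemma Cmul_eq0 (z w : Cpx) : Cmul z w = C0 -> z = C0 \/ w = C0.
Proof.
  intros H; destruct (Ceq_dec z C0) as [h|h]; [now left|right].
  replace w with (Cmul (Cinv z) (Cmul z w)) by (field; exact h).
  rewrite H; ring.
Qed.

Lemma Cmul_neq0 (z w : Cpx) : z <> C0 -> w <> C0 -> Cmul z w <> C0.
Proof. intros hz hw H; destruct (Cmul_eq0 _ _ H); contradiction. Qed.

Lemma Cinv_neq0 (z : Cpx) : z <> C0 -> Cinv z <> C0.
Proof.
  intros hz H; apply C1_neq0; replace C1 with (Cmul (Cinv z) z) by (field; exact hz).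
  rewrite H; ring.
Qed.

Lemma Cdiv_neq0 (z w : Cpx) : z <> C0 -> w <> C0 -> Cdiv z w <> C0.
Proof. intros hz hw; apply Cmul_neq0; [|apply Cinv_neq0]; assumption. Qed.

Lemma Cnorm2_mul (z w : Cpx) : Cnorm2 (Cmul z w) = Cnorm2 z * Cnorm2 w.
Proof. unfold Cnorm2, Cmul; simpl; ring. Qed.

Lemma Cabs_ge0 (z : Cpx) : 0 <= Cabs z.
Proof. apply sqrt_pos. Qed.

Lemma Cabs_gt0 (z : Cpx) : z <> C0 -> 0 < Cabs z.
Proof. intros h; apply sqrt_lt_R0, Cnorm2_gt0, h. Qed.

Lemma Cabs_sqr (z : Cpx) : Cabs z * Cabs z = Cnorm2 z.
Proof. apply sqrt_sqrt, Cnorm2_ge0. Qed.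

Lemma Cabs_add_le (z w : Cpx) : Cabs (Cadd z w) <= Cabs z + Cabs w.
Proof.
  pose proof (Cabs_ge0 z); pose proof (Cabs_ge0 w); pose proof (Cabs_ge0 (Cadd z w)).
  pose proof (Cabs_sqr z) as Hz; pose proof (Cabs_sqr w) as Hw.
  pose proof (Cabs_sqr (Cadd z w)) as Hs.
  assert (Hcs : fst z * fst w + snd z * snd w <= Cabs z * Cabs w).
  { apply Rsqr_incr_0_var; [|apply Rmult_le_pos; assumption].
    unfold Rsqr.
    replace (Cabs z * Cabs w * (Cabs z * Cabs w)) with (Cnorm2 z * Cnorm2 w)
      by (rewrite <- Hz, <- Hw; ring).
    (* Lagrange's identity: the gap in the Cauchy-Schwarz inequality is the square of this
       determinant. *)
    unfold Cnorm2; pose proof (Rle_0_sqr (fst z * snd w - snd z * fst w)) as Hq.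
    unfold Rsqr in Hq; nra. }
  apply Rsqr_incr_0_var; [|lra].
  unfold Rsqr; rewrite Hs.
  unfold Cnorm2, Cadd in *; simpl; nra.
Qed.

Lemma Rabs_fst_le_Cabs (z : Cpx) : Rabs (fst z) <= Cabs z.
Proof. rewrite <- sqrt_Rsqr_abs; apply sqrt_le_1_alt; unfold Rsqr, Cnorm2; nra. Qed.

Lemma Rabs_snd_le_Cabs (z : Cpx) : Rabs (snd z) <= Cabs z.
Proof. rewrite <- sqrt_Rsqr_abs; apply sqrt_le_1_alt; unfold Rsqr, Cnorm2; nra. Qed.

Lemma Cabs_le_Rabs (z : Cpx) : Cabs z <= Rabs (fst z) + Rabs (snd z).
Proof.
  pose proof (Rabs_pos (fst z)); pose proof (Rabs_pos (snd z)).
  apply Rsqr_incr_0_var; [|lra].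
  unfold Rsqr; rewrite Cabs_sqr; unfold Cnorm2.
  pose proof (Rsqr_abs (fst z)); pose proof (Rsqr_abs (snd z)); unfold Rsqr in *; nra.
Qed.

Lemma Cexp_add (z w : Cpx) : Cexp (Cadd z w) = Cmul (Cexp z) (Cexp w).
Proof.
  unfold Cexp, Cadd, Cmul; apply Cpx_ext; simpl; rewrite exp_plus;
    [rewrite cos_plus | rewrite sin_plus]; ring.
Qed.

Lemma Cnorm2_exp (z : Cpx) : Cnorm2 (Cexp z) = exp (fst z) * exp (fst z).
Proof.
  unfold Cnorm2, Cexp; simpl; pose proof (sin2_cos2 (snd z)) as H; unfold Rsqr in H.
  nra.
Qed.

Lemma Cabs_exp (z : Cpx) : Cabs (Cexp z) = exp (fst z).
Proof.
  unfold Cabs; rewrite Cnorm2_exp; apply sqrt_square.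
  left; apply exp_pos.
Qed.

Lemma Cexp_neq0 (z : Cpx) : Cexp z <> C0.
Proof.
  intros H; pose proof (Cnorm2_exp z) as Hn; rewrite H in Hn.
  pose proof (exp_pos (fst z)); unfold Cnorm2, C0 in Hn; simpl in Hn; nra.
Qed.

Lemma Cexp_0 : Cexp C0 = C1.
Proof. unfold Cexp, C0, C1; simpl; rewrite exp_0, cos_0, sin_0; f_equal; ring. Qed.

Lemma Cexp_surj (z : Cpx) : z <> C0 -> exists u, Cexp u = z.
Proof.
  intros h; pose proof (Cabs_gt0 z h) as Hp; pose proof (Cabs_sqr z) as Hs.
  unfold Cnorm2 in Hs.
  assert (Ha : (fst z / Cabs z) * (fst z / Cabs z) + (snd z / Cabs z) * (snd z / Cabs z) = 1).
  { transitivity ((fst z * fst z + snd z * snd z) / (Cabs z * Cabs z)); [field; lra|].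
    rewrite Hs; field; nra. }
  set (a := fst z / Cabs z) in *; set (b := snd z / Cabs z) in *.
  assert (hz : z = (Cabs z * a, Cabs z * b))
    by (apply Cpx_ext; unfold a, b; simpl; field; lra).
  assert (Hr : -1 <= a <= 1) by nra.
  assert (Hsin : sin (acos a) = Rabs b).
  { rewrite sin_acos by exact Hr; unfold Rsqr.
    replace (1 - a * a) with (Rsqr b) by (unfold Rsqr; lra); apply sqrt_Rsqr_abs. }
  (* [acos] only yields angles in [[0, PI]], where the sine is nonnegative; the lower half plane
     takes the opposite angle. *)
  destruct (Rle_dec 0 b) as [hb|hb].
  - exists (ln (Cabs z), acos a); unfold Cexp; simpl.
    rewrite exp_ln, cos_acos, Hsin, Rabs_pos_eq by assumption; now symmetry.
  - exists (ln (Cabs z), - acos a); unfold Cexp; simpl.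
    rewrite exp_ln, cos_neg, sin_neg, cos_acos, Hsin, Rabs_left by lra.
    rewrite Ropp_involutive; now symmetry.
Qed.

Lemma Cexp_eq1 (z : Cpx) : Cexp z = C1 -> exists k : Z, z = (0, 2 * PI * IZR k).
Proof.
  intros H.
  assert (Hf : fst z = 0).
  { pose proof (Cabs_exp z) as Ha; rewrite H in Ha.
    unfold Cabs, Cnorm2, C1 in Ha; simpl in Ha.
    replace (1 * 1 + 0 * 0) with 1 in Ha by ring; rewrite sqrt_1 in Ha.
    apply exp_inv; rewrite exp_0; now symmetry. }
  unfold Cexp in H; rewrite Hf, exp_0 in H; injection H as Hc Hs.
  (* Passing to the half angle gives multiples of [2 PI]; the vanishing of the sine of [snd z] alone
     would only give multiples of [PI]. *)
  assert (Hh : sin (snd z / 2) = 0).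
  { pose proof (cos_2a_sin (snd z / 2)) as H2.
    replace (2 * (snd z / 2)) with (snd z) in H2 by field; nra. }
  destruct (sin_eq_0_0 _ Hh) as [k Hk]; exists k.
  apply Cpx_ext; simpl; [exact Hf|lra].
Qed.

Lemma Cexp_2PI (k : Z) : Cexp (0, 2 * PI * IZR k) = C1.
Proof.
  unfold Cexp, C1; simpl; rewrite exp_0.
  assert (Hs : sin (PI * IZR k) = 0)
    by (apply sin_eq_0_1; exists k; ring).
  replace (2 * PI * IZR k) with (2 * (PI * IZR k)) by ring.
  rewrite sin_2a, cos_2a_sin, Hs; apply Cpx_ext; simpl; ring.
Qed.

Lemma Cexp_sub (z w : Cpx) : Cexp z = Cmul (Cexp (Csub z w)) (Cexp w).
Proof. rewrite <- Cexp_add; f_equal; ring. Qed.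

Lemma Cexp_sub_eq (z w c : Cpx) : Cexp z = Cmul c (Cexp w) -> Cexp (Csub z w) = c.
Proof.
  intros H; rewrite (Cexp_sub z w) in H; pose proof (Cexp_neq0 w) as h.
  replace (Cexp (Csub z w)) with (Cdiv (Cmul (Cexp (Csub z w)) (Cexp w)) (Cexp w))
    by (field; exact h).
  rewrite H; field; exact h.
Qed.

(** * Lifting nonvanishing maps through the exponential *)

Definition cont (g : Cpx -> R) (z : Cpx) : Prop :=
  @continuous (prod_UniformSpace R_UniformSpace R_UniformSpace) R_UniformSpace g z.

Definition Ccont (h : Cpx -> Cpx) (z : Cpx) : Prop :=
  cont (fun w => fst (h w)) z /\ cont (fun w => snd (h w)) z.

(** Balls of the product uniform structure are boxes, hence the separate bounds on the two
    coordinates. *)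
Lemma cont_eps (g : Cpx -> R) (z : Cpx) :
  cont g z <->
  forall eps, 0 < eps -> exists d, 0 < d /\
    forall w, Rabs (fst w - fst z) < d -> Rabs (snd w - snd z) < d ->
      Rabs (g w - g z) < eps.
Proof.
  unfold cont, continuous; split.
  - intros H eps he.
    destruct (H (ball (g z) (mkposreal eps he)) (locally_ball _ _)) as [d Hd].
    exists d; split; [apply cond_pos|]; intros w h1 h2.
    apply Hd; split; assumption.
  - intros H; apply filterlim_locally; intros eps.
    destruct (H eps (cond_pos eps)) as [d [hd Hd]].
    exists (mkposreal d hd); intros w [h1 h2]; apply Hd; assumption.
Qed.

Lemma cont_const (c : R) (z : Cpx) : cont (fun _ => c) z.
Proof. apply continuous_const. Qed.

Lemma cont_fst (z : Cpx) : cont (fun w => fst w) z.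
Proof. destruct z; apply (continuous_fst (U := R_UniformSpace) (V := R_UniformSpace)). Qed.

Lemma cont_snd (z : Cpx) : cont (fun w => snd w) z.
Proof. destruct z; apply (continuous_snd (U := R_UniformSpace) (V := R_UniformSpace)). Qed.

Lemma cont_plus (f g : Cpx -> R) (z : Cpx) :
  cont f z -> cont g z -> cont (fun w => f w + g w) z.
Proof. apply (continuous_plus (V := R_NormedModule)). Qed.

Lemma cont_minus (f g : Cpx -> R) (z : Cpx) :
  cont f z -> cont g z -> cont (fun w => f w - g w) z.
Proof. apply (continuous_minus (V := R_NormedModule)). Qed.

Lemma cont_opp (f : Cpx -> R) (z : Cpx) : cont f z -> cont (fun w => - f w) z.
Proof. apply (continuous_opp (V := R_NormedModule)). Qed.

Lemma cont_mult (f g : Cpx -> R) (z : Cpx) :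
  cont f z -> cont g z -> cont (fun w => f w * g w) z.
Proof. apply (continuous_mult (K := R_AbsRing)). Qed.

Lemma cont_comp (phi : R -> R) (g : Cpx -> R) (z : Cpx) :
  continuity_pt phi (g z) -> cont g z -> cont (fun w => phi (g w)) z.
Proof.
  intros hp hg; apply (continuous_comp (V := R_UniformSpace) g phi); [exact hg|].
  now apply continuity_pt_filterlim.
Qed.

Lemma cont_inv (g : Cpx -> R) (z : Cpx) :
  g z <> 0 -> cont g z -> cont (fun w => / g w) z.
Proof.
  intros h; apply (cont_comp Rinv).
  apply (continuity_pt_inv (fun x => x)); [apply continuity_pt_id | exact h].
Qed.

Lemma cont_compC (g : Cpx -> R) (h : Cpx -> Cpx) (z : Cpx) :
  Ccont h z -> cont g (h z) -> cont (fun w => g (h w)) z.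
Proof.
  intros [h1 h2] hg; apply cont_eps; intros eps he.
  destruct (proj1 (cont_eps _ _) hg eps he) as [d [hd Hd]].
  destruct (proj1 (cont_eps _ _) h1 d hd) as [d1 [hd1 Hd1]].
  destruct (proj1 (cont_eps _ _) h2 d hd) as [d2 [hd2 Hd2]].
  exists (Rmin d1 d2); split; [now apply Rmin_pos|].
  intros w a b; pose proof (Rmin_l d1 d2); pose proof (Rmin_r d1 d2).
  apply Hd; [apply Hd1 | apply Hd2]; lra.
Qed.

Lemma Ccont_comp (g h : Cpx -> Cpx) (z : Cpx) :
  Ccont h z -> Ccont g (h z) -> Ccont (fun w => g (h w)) z.
Proof.
  intros hh [g1 g2]; split.
  - exact (cont_compC (fun w => fst (g w)) h z hh g1).
  - exact (cont_compC (fun w => snd (g w)) h z hh g2).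
Qed.

(** Needed for maps obtained by gluing or by a case distinction, which agree with a visibly
    continuous map only near [z]. *)
Lemma cont_ext_loc (f g : Cpx -> R) (z : Cpx) (d : R) :
  0 < d ->
  (forall w, Rabs (fst w - fst z) < d -> Rabs (snd w - snd z) < d -> f w = g w) ->
  cont f z -> cont g z.
Proof.
  intros hd H hf; apply cont_eps; intros eps he.
  destruct (proj1 (cont_eps _ _) hf eps he) as [d' [hd' Hd']].
  exists (Rmin d d'); split; [now apply Rmin_pos|].
  intros w a b; pose proof (Rmin_l d d'); pose proof (Rmin_r d d').
  rewrite <- (H w), <- (H z) by (try (rewrite Rminus_diag, Rabs_R0); lra).
  apply Hd'; lra.
Qed.

(** Restriction to a segment opens the way to the one-variable intermediate value theorem. *)
Lemma cont_segment (g : Cpx -> R) (z w : Cpx) (t : R) :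
  cont g (Cadd z (Cmul (RtoC t) w)) ->
  continuity_pt (fun s => g (Cadd z (Cmul (RtoC s) w))) t.
Proof.
  intros hg; apply continuity_pt_filterlim.
  pose proof (proj1 (cont_eps _ _) hg) as Hg.
  apply filterlim_locally; intros eps.
  destruct (Hg eps (cond_pos eps)) as [d [hd Hd]].
  set (K := 1 + Rabs (fst w) + Rabs (snd w)).
  pose proof (Rabs_pos (fst w)) as p1; pose proof (Rabs_pos (snd w)) as p2.
  assert (hdK : 0 < d / K) by (apply Rdiv_lt_0_compat; unfold K; lra).
  exists (mkposreal _ hdK); intros s hs.
  change (Rabs (s - t) < d / K) in hs; apply Hd.
  all: unfold Cadd, Cmul, RtoC; simpl.
  - replace (_ - _) with ((s - t) * fst w) by ring.
    rewrite Rabs_mult; apply Rle_lt_trans with (Rabs (s - t) * K).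
    + apply Rmult_le_compat_l; [apply Rabs_pos | unfold K; lra].
    + apply Rlt_div_r in hs; [exact hs | unfold K; lra].
  - replace (_ - _) with ((s - t) * snd w) by ring.
    rewrite Rabs_mult; apply Rle_lt_trans with (Rabs (s - t) * K).
    + apply Rmult_le_compat_l; [apply Rabs_pos | unfold K; lra].
    + apply Rlt_div_r in hs; [exact hs | unfold K; lra].
Qed.

Lemma Ccont_exp (z : Cpx) : Ccont Cexp z.
Proof.
  split; unfold Cexp; simpl; apply cont_mult.
  1, 3: apply (cont_comp exp); [apply derivable_continuous_pt, derivable_pt_exp | apply cont_fst].
  - apply (cont_comp cos); [apply continuity_cos | apply cont_snd].
  - apply (cont_comp sin); [apply continuity_sin | apply cont_snd].
Qed.

Lemma uniform_continuity_box (g : Cpx -> R) (M eps : R) :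
  (forall z, cont g z) -> 0 < eps ->
  exists d, 0 < d /\ forall z w,
    Rabs (fst z) <= M -> Rabs (snd z) <= M -> Rabs (fst w) <= M -> Rabs (snd w) <= M ->
    Rabs (fst w - fst z) < d -> Rabs (snd w - snd z) < d -> Rabs (g w - g z) < eps.
Proof.
  intros hg he.
  destruct (uniform_continuity_2d (fun x y => g (x, y)) (- M) M (- M) M)
    with (eps := mkposreal eps he) as [d Hd].
  { intros x y _ _; apply continuity_2d_pt_filterlim.
    apply filterlim_ext with (fun z : R * R => g z); [now intros [? ?]|].
    apply hg. }
  exists d; split; [apply cond_pos|].
  intros [z1 z2] [w1 w2]; simpl; intros a1 a2 a3 a4 b1 b2.
  apply (Hd z1 z2 w1 w2); try assumption; now apply Rabs_le_between.
Qed.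

Lemma scaled_coord_le (x M t : R) : 0 <= t <= 1 -> Rabs x <= M -> Rabs (t * x) <= M.
Proof.
  intros ht hx; rewrite Rabs_mult, (Rabs_pos_eq t) by lra.
  pose proof (Rabs_pos x); nra.
Qed.

Lemma scale_step_lt (x M d : R) (N k : nat) :
  Rabs x <= M -> (0 < N)%nat -> M / INR N < d ->
  Rabs (INR (S k) / INR N * x - INR k / INR N * x) < d.
Proof.
  intros hx hN hd; apply lt_0_INR in hN.
  replace (_ - _) with (x / INR N) by (rewrite S_INR; field; lra).
  unfold Rdiv; rewrite Rabs_mult, (Rabs_pos_eq (/ INR N))
    by (left; now apply Rinv_0_lt_compat).
  apply Rle_lt_trans with (M / INR N); [|exact hd].
  apply Rmult_le_compat_r; [left; now apply Rinv_0_lt_compat | exact hx].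
Qed.

Lemma scale_ratio_bounds (k N : nat) : (0 < N)%nat -> (k <= N)%nat -> 0 <= INR k / INR N <= 1.
Proof.
  intros hN hk; apply lt_0_INR in hN; apply le_INR in hk; pose proof (pos_INR k).
  split; [now apply Rdiv_le_0_compat | apply Rle_div_l; lra].
Qed.

(** Chain argument: consecutive points [k z / N] are so close that [g] changes by less than 1
    between them, and [N] does not depend on [z]. *)
Lemma cont_bounded_box (g : Cpx -> R) (M : R) :
  (forall z, cont g z) ->
  exists K, forall z, Rabs (fst z) <= M -> Rabs (snd z) <= M -> Rabs (g z) <= K.
Proof.
  intros hg; destruct (uniform_continuity_box g M 1 hg Rlt_0_1) as [d [hd Hd]].
  destruct (INR_archimed d M hd) as [N0 hN0].
  (* The successor keeps [N] positive even if the archimedean property returned 0. *)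
  set (N := S N0).
  assert (hN : (0 < N)%nat) by (unfold N; lia).
  assert (hMN : M / INR N < d).
  { apply Rlt_div_l; [now apply lt_0_INR|]; unfold N; rewrite S_INR; lra. }
  assert (Hk : forall z k, (k <= N)%nat -> Rabs (fst z) <= M -> Rabs (snd z) <= M ->
    Rabs (g (INR k / INR N * fst z, INR k / INR N * snd z)) <= Rabs (g C0) + INR k).
  { intros [x y] k hk hz1 hz2; cbv beta iota delta [fst snd] in *; induction k as [|k IH].
    - replace (INR 0 / INR N) with 0
        by (simpl INR; unfold Rdiv; ring).
      rewrite !Rmult_0_l; change (0, 0) with C0; simpl; lra.
    - pose proof (scale_ratio_bounds k N hN ltac:(lia)) as b1.
      pose proof (scale_ratio_bounds (S k) N hN hk) as b2.
      specialize (IH ltac:(lia)).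
      assert (Hs := Hd (INR k / INR N * x, INR k / INR N * y)
        (INR (S k) / INR N * x, INR (S k) / INR N * y)).
      cbv beta iota delta [fst snd] in Hs.
      specialize (Hs (scaled_coord_le _ _ _ b1 hz1) (scaled_coord_le _ _ _ b1 hz2)
        (scaled_coord_le _ _ _ b2 hz1) (scaled_coord_le _ _ _ b2 hz2)
        (scale_step_lt _ _ _ _ _ hz1 hN hMN) (scale_step_lt _ _ _ _ _ hz2 hN hMN)).
      pose proof (S_INR k) as hS.
      match type of Hs with Rabs (?a - ?b) < _ =>
        pose proof (Rabs_triang (a - b) b) as Ht; replace (a - b + b) with a in Ht by ring
      end.
      lra. }
  exists (Rabs (g C0) + INR N); intros z hz1 hz2.
  specialize (Hk z N (le_n _) hz1 hz2).
  replace (INR N / INR N) with 1 in Hk by (field; apply not_0_INR; lia).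
  rewrite !Rmult_1_l in Hk; now destruct z.
Qed.

(** * Continuous angles of maps to the unit circle *)

Lemma atan_ratio_polar (c s : R) :
  0 < c -> c * c + s * s = 1 -> cos (atan (s / c)) = c /\ sin (atan (s / c)) = s.
Proof.
  intros hc hcs; rewrite cos_atan, sin_atan.
  replace (1 + (s / c)²) with ((/ c)²)
    by (unfold Rsqr; transitivity ((c * c + s * s) / (c * c)); [rewrite hcs|]; field; lra).
  rewrite sqrt_Rsqr by (left; now apply Rinv_0_lt_compat).
  split; field; lra.
Qed.

(* Along the ray from 0 to z the angle is accumulated in N small steps, each below a
   right angle, so that each increment is given by the arctangent. *)
Lemma angle_lift_box (u1 u2 : Cpx -> R) (t0 M : R) :
  (forall z, cont u1 z) -> (forall z, cont u2 z) ->
  (forall z, u1 z * u1 z + u2 z * u2 z = 1) ->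
  cos t0 = u1 C0 -> sin t0 = u2 C0 ->
  exists th : Cpx -> R, th C0 = t0 /\
    forall z, Rabs (fst z) <= M -> Rabs (snd z) <= M ->
      cont th z /\ cos (th z) = u1 z /\ sin (th z) = u2 z.
Proof.
  intros hu1 hu2 hu ht1 ht2.
  (* For unit vectors the inner product is 1 minus half the squared distance. With both coordinates
     changing by less than 1/2 it exceeds 3/4, so the turn is below a right angle. *)
  destruct (uniform_continuity_box u1 M (1 / 2) hu1 ltac:(lra)) as [d1 [hd1 Hd1]].
  destruct (uniform_continuity_box u2 M (1 / 2) hu2 ltac:(lra)) as [d2 [hd2 Hd2]].
  set (d := Rmin d1 d2).
  assert (hd : 0 < d) by now apply Rmin_pos.
  destruct (INR_archimed d M hd) as [N0 hN0].
  set (N := S N0).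
  assert (hN : (0 < N)%nat) by (unfold N; lia).
  assert (hMN : M / INR N < d).
  { apply Rlt_div_l; [now apply lt_0_INR|]; unfold N; rewrite S_INR; lra. }
  assert (hMN1 : M / INR N < d1) by (pose proof (Rmin_l d1 d2); unfold d in *; lra).
  assert (hMN2 : M / INR N < d2) by (pose proof (Rmin_r d1 d2); unfold d in *; lra).
  set (sc := fun (k : nat) (z : Cpx) => (INR k / INR N * fst z, INR k / INR N * snd z) : Cpx).
  assert (hsc : forall k z, Ccont (sc k) z).
  { intros k z; split; unfold sc; simpl; apply cont_mult;
      try apply cont_const; [apply cont_fst | apply cont_snd]. }
  (* Stage [k] lifts [z |-> u (k z / N)], so the stages lead from the constant [u C0] to [u]
     itself. *)
  assert (Hk : forall k, (k <= N)%nat -> exists th : Cpx -> R, th C0 = t0 /\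
    forall z, Rabs (fst z) <= M -> Rabs (snd z) <= M ->
      cont th z /\ cos (th z) = u1 (sc k z) /\ sin (th z) = u2 (sc k z)).
  { induction k as [|k IH]; intros hk.
    - exists (fun _ => t0); split; [reflexivity|]; intros z _ _.
      split; [apply cont_const|].
      replace (sc 0%nat z) with C0; [now split|].
      unfold sc, C0; simpl INR; f_equal; unfold Rdiv; ring.
    - destruct (IH ltac:(lia)) as [th [hth0 Hth]].
      (* [rc] and [rs] are the cosine and sine of the angle from the direction at [sc k z] to the
         one at [sc (S k) z]. *)
      set (rc := fun z => u1 (sc (S k) z) * u1 (sc k z) + u2 (sc (S k) z) * u2 (sc k z)).
      set (rs := fun z => u2 (sc (S k) z) * u1 (sc k z) - u1 (sc (S k) z) * u2 (sc k z)).
      assert (hc1 : forall j z, cont (fun w => u1 (sc j w)) z)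
        by (intros j z; apply cont_compC; [apply hsc | apply hu1]).
      assert (hc2 : forall j z, cont (fun w => u2 (sc j w)) z)
        by (intros j z; apply cont_compC; [apply hsc | apply hu2]).
      exists (fun z => th z + atan (rs z / rc z)); split.
      { replace (rs C0) with 0; [unfold Rdiv; rewrite Rmult_0_l, atan_0, hth0; ring|].
        assert (h0 : forall j, sc j C0 = C0) by (intros j; unfold sc, C0; simpl; f_equal; ring).
        unfold rs; rewrite !h0; ring. }
      intros z hz1 hz2; destruct (Hth z hz1 hz2) as [hct [hcos hsin]].
      pose proof (scale_ratio_bounds k N hN ltac:(lia)) as b1.
      pose proof (scale_ratio_bounds (S k) N hN hk) as b2.
      assert (e1 : Rabs (u1 (sc (S k) z) - u1 (sc k z)) < 1 / 2).
      { apply Hd1; unfold sc; cbv beta iota delta [fst snd]; fold (fst z); fold (snd z).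
        1-4: now apply scaled_coord_le.
        all: now apply scale_step_lt with (M := M). }
      assert (e2 : Rabs (u2 (sc (S k) z) - u2 (sc k z)) < 1 / 2).
      { apply Hd2; unfold sc; cbv beta iota delta [fst snd]; fold (fst z); fold (snd z).
        1-4: now apply scaled_coord_le.
        all: now apply scale_step_lt with (M := M). }
      pose proof (hu (sc k z)) as n1; pose proof (hu (sc (S k) z)) as n2.
      assert (hrc : 0 < rc z).
      { unfold rc; apply Rabs_def2 in e1; apply Rabs_def2 in e2; nra. }
      assert (hcs : rc z * rc z + rs z * rs z = 1).
      { unfold rc, rs.
        transitivity ((u1 (sc k z) * u1 (sc k z) + u2 (sc k z) * u2 (sc k z)) *
          (u1 (sc (S k) z) * u1 (sc (S k) z) + u2 (sc (S k) z) * u2 (sc (S k) z))); [ring|].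
        rewrite n1, n2; ring. }
      destruct (atan_ratio_polar _ _ hrc hcs) as [ha1 ha2].
      split; [|split].
      + apply cont_plus; [exact hct|].
        apply (cont_comp atan).
        * apply derivable_continuous_pt, derivable_pt_atan.
        * apply cont_mult.
          -- apply cont_minus; apply cont_mult; auto.
          -- apply cont_inv; [lra|]; apply cont_plus; apply cont_mult; auto.
      + rewrite cos_plus, ha1, ha2, hcos, hsin; unfold rc, rs.
        transitivity (u1 (sc (S k) z) * (u1 (sc k z) * u1 (sc k z) + u2 (sc k z) * u2 (sc k z)));
          [ring | rewrite n1; ring].
      + rewrite sin_plus, ha1, ha2, hcos, hsin; unfold rc, rs.
        transitivity (u2 (sc (S k) z) * (u1 (sc k z) * u1 (sc k z) + u2 (sc k z) * u2 (sc k z)));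
          [ring | rewrite n1; ring]. }
  destruct (Hk N (le_n _)) as [th [h0 H]]; exists th; split; [exact h0|].
  intros z hz1 hz2; specialize (H z hz1 hz2).
  replace (sc N z) with z in H; [exact H|].
  assert (hI : INR N <> 0) by (apply not_0_INR; lia).
  unfold sc; apply Cpx_ext; cbn [fst snd]; field; exact hI.
Qed.

(** A nonzero value at 1 has absolute value at least [2 PI], so [d] or [- d] would take the value
    [PI] on the way, which is no multiple of [2 PI]. *)
Lemma continuous_period_multiple_const (d : R -> R) :
  (forall t, 0 <= t <= 1 -> continuity_pt d t) ->
  (forall t, 0 <= t <= 1 -> exists k : Z, d t = 2 * PI * IZR k) ->
  d 0 = 0 -> d 1 = 0.
Proof.
  assert (Hpos : forall e : R -> R,
    (forall t, 0 <= t <= 1 -> continuity_pt e t) ->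
    (forall t, 0 <= t <= 1 -> exists k : Z, e t = 2 * PI * IZR k) ->
    e 0 = 0 -> ~ 0 < e 1).
  { intros e hc hk h0 h1; pose proof PI_RGT_0 as hpi.
    destruct (Ranalysis5.IVT_interv (fun t => e t - PI) 0 1) as [t [ht Ht]].
    - intros t ht; apply (continuity_pt_minus e (fun _ => PI)); [now apply hc|].
      apply continuity_pt_const; now intros ? ?.
    - lra.
    - lra.
    - destruct (hk 1 ltac:(lra)) as [k Hk]; rewrite Hk in h1 |- *.
      assert (hk1 : (1 <= k)%Z) by (assert (0 < k)%Z by (apply lt_IZR; nra); lia).
      apply IZR_le in hk1; nra.
    - destruct (hk t ht) as [k Hk].
      assert (h : 2 * IZR k = 1) by nra.
      change 2 with (IZR 2) in h; rewrite <- mult_IZR in h; apply eq_IZR in h; lia. }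
  intros hc hk h0.
  destruct (Rtotal_order (d 1) 0) as [h|[h|h]]; [|exact h|].
  - exfalso; apply (Hpos (fun t => - d t)); [| | |lra].
    + intros t ht; now apply continuity_pt_opp, hc.
    + intros t ht; destruct (hk t ht) as [k Hk]; exists (- k)%Z.
      rewrite opp_IZR, Hk; ring.
    + lra.
  - exfalso; now apply (Hpos d).
Qed.

Lemma angle_eq_mod (a b : R) :
  cos a = cos b -> sin a = sin b -> exists k : Z, a - b = 2 * PI * IZR k.
Proof.
  intros hc hs; destruct (Cexp_eq1 (Csub (0, a) (0, b))) as [k Hk].
  - apply Cexp_sub_eq; unfold Cexp, Cmul, C1; simpl; rewrite hc, hs; apply Cpx_ext; simpl; ring.
  - exists k; injection Hk; intros H _; exact H.
Qed.

(** Along the segment the difference of the two angles is continuous with values in [2 PI Z]. Asking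
    for the hypotheses on the segment only lets lifts over boxes be compared. *)
Lemma angle_lift_unique (a b : Cpx -> R) (z w : Cpx) :
  (forall t, 0 <= t <= 1 ->
    let p := Cadd z (Cmul (RtoC t) w) in
    cont a p /\ cont b p /\ cos (a p) = cos (b p) /\ sin (a p) = sin (b p)) ->
  a z = b z -> a (Cadd z w) = b (Cadd z w).
Proof.
  intros H h0.
  set (d := fun t => a (Cadd z (Cmul (RtoC t) w)) - b (Cadd z (Cmul (RtoC t) w))).
  assert (H1 : d 1 = 0).
  { apply (continuous_period_multiple_const d); unfold d.
    - intros t ht; destruct (H t ht) as [ha [hb _]].
      apply continuity_pt_minus; now apply cont_segment.
    - intros t ht; destruct (H t ht) as [_ [_ [hc hs]]]; now apply angle_eq_mod.
    - replace (Cadd z (Cmul (RtoC 0) w)) with z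
        by (change (RtoC 0) with C0; ring).
      lra. }
  unfold d in H1; replace (Cmul (RtoC 1) w) with w in H1 by (change (RtoC 1) with C1; ring).
  lra.
Qed.

(** Lifts over growing boxes share the value [t0] at the origin, hence agree on overlaps by
    uniqueness along rays, and glue to a lift on the plane. *)
Lemma angle_lift (u1 u2 : Cpx -> R) :
  (forall z, cont u1 z) -> (forall z, cont u2 z) ->
  (forall z, u1 z * u1 z + u2 z * u2 z = 1) ->
  exists th : Cpx -> R, forall z, cont th z /\ cos (th z) = u1 z /\ sin (th z) = u2 z.
Proof.
  intros hu1 hu2 hu.
  assert (Ht0 : exists t0, cos t0 = u1 C0 /\ sin t0 = u2 C0).
  { destruct (Cexp_surj (u1 C0, u2 C0)) as [u Hu].
    - intros h; injection h as h1 h2; pose proof (hu C0) as h; rewrite h1, h2 in h; lra.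
    - pose proof (Cnorm2_exp u) as Hn; rewrite Hu in Hn; unfold Cnorm2 in Hn; simpl in Hn.
      rewrite hu in Hn; pose proof (exp_pos (fst u)).
      assert (he : exp (fst u) = 1) by nra.
      unfold Cexp in Hu; rewrite he in Hu; injection Hu as e1 e2.
      exists (snd u); lra. }
  destruct Ht0 as [t0 [ht1 ht2]].
  set (Pr := fun (n : nat) (th : Cpx -> R) => th C0 = t0 /\
    forall z, Rabs (fst z) <= INR n -> Rabs (snd z) <= INR n ->
      cont th z /\ cos (th z) = u1 z /\ sin (th z) = u2 z).
  assert (Hex : forall n, exists th, Pr n th)
    by (intros n; now apply angle_lift_box).
  pose (L := fun n => proj1_sig (constructive_indefinite_description _ (Hex n))).
  assert (HL : forall n, Pr n (L n))
    by (intros n; exact (proj2_sig (constructive_indefinite_description _ (Hex n)))).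
  assert (Hagree : forall n m z,
    Rabs (fst z) <= INR n -> Rabs (snd z) <= INR n ->
    Rabs (fst z) <= INR m -> Rabs (snd z) <= INR m -> L n z = L m z).
  { intros n m z n1 n2 m1 m2.
    destruct (HL n) as [hn Hn]; destruct (HL m) as [hm Hm].
    replace z with (Cadd C0 z) by ring.
    apply angle_lift_unique; [|now rewrite hn, hm].
    intros t ht; replace (Cadd C0 (Cmul (RtoC t) z)) with ((t * fst z, t * snd z) : Cpx)
      by (apply Cpx_ext; unfold Cadd, C0, Cmul, RtoC; simpl; ring).
    destruct (Hn (t * fst z, t * snd z)) as [c1 [c2 c3]];
      [simpl; now apply scaled_coord_le .. |].
    destruct (Hm (t * fst z, t * snd z)) as [d1 [d2 d3]];
      [simpl; now apply scaled_coord_le .. |].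
    cbv zeta; rewrite c2, c3, d2, d3; repeat split; assumption. }
  (* The margin 1 keeps a whole neighbourhood of [z] inside the box chosen for [z]; there the glued
     angle coincides with a single [L n], which gives its continuity. *)
  assert (Hbig : forall z : Cpx, exists n, Rabs (fst z) + Rabs (snd z) + 1 <= INR n).
  { intros z; destruct (INR_archimed 1 (Rabs (fst z) + Rabs (snd z) + 1) Rlt_0_1) as [n hn].
    exists n; lra. }
  pose (ix := fun z => proj1_sig (constructive_indefinite_description _ (Hbig z))).
  assert (Hix : forall z, Rabs (fst z) + Rabs (snd z) + 1 <= INR (ix z))
    by (intros z; exact (proj2_sig (constructive_indefinite_description _ (Hbig z)))).
  exists (fun z => L (ix z) z); intros z.
  pose proof (Hix z) as hz; pose proof (Rabs_pos (fst z)); pose proof (Rabs_pos (snd z)).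
  destruct (HL (ix z)) as [_ Hz]; destruct (Hz z ltac:(lra) ltac:(lra)) as [hc hcs].
  split; [|exact hcs].
  apply (cont_ext_loc (L (ix z)) _ z 1 Rlt_0_1); [|exact hc].
  intros w h1 h2; pose proof (Hix w); pose proof (Rabs_pos (fst w)); pose proof (Rabs_pos (snd w)).
  pose proof (Rabs_triang (fst w - fst z) (fst z)) as T1.
  pose proof (Rabs_triang (snd w - snd z) (snd z)) as T2.
  replace (fst w - fst z + fst z) with (fst w) in T1 by ring.
  replace (snd w - snd z + snd z) with (snd w) in T2 by ring.
  apply Hagree; lra.
Qed.

Lemma continuity_pt_ln (x : R) : 0 < x -> continuity_pt ln x.
Proof.
  intros h; apply derivable_continuous_pt; exists (/ x); now apply derivable_pt_lim_ln.
Qed.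

Lemma cont_Cabs (h : Cpx -> Cpx) (z : Cpx) : Ccont h z -> cont (fun w => Cabs (h w)) z.
Proof.
  intros [h1 h2]; apply (cont_comp sqrt); [apply continuity_pt_sqrt, Cnorm2_ge0|].
  apply cont_plus; now apply cont_mult.
Qed.

(** [h] composed with [Cexp] is a nonvanishing map on the whole plane, so it has a continuous
    logarithm: the real part is the logarithm of the modulus, the imaginary part a lifted angle. *)
Lemma exp_lift (h : Cpx -> Cpx) :
  (forall z, z <> C0 -> h z <> C0) -> (forall z, z <> C0 -> Ccont h z) ->
  exists F : Cpx -> Cpx, (forall z, Ccont F z) /\ forall z, Cexp (F z) = h (Cexp z).
Proof.
  intros hnz hc.
  set (g := fun z => h (Cexp z)).
  assert (hg : forall z, Ccont g z)
    by (intros z; apply (Ccont_comp h Cexp); [apply Ccont_exp | apply hc, Cexp_neq0]).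
  assert (hpos : forall z, 0 < Cabs (g z)) by (intros z; apply Cabs_gt0, hnz, Cexp_neq0).
  destruct (angle_lift (fun z => fst (g z) * / Cabs (g z)) (fun z => snd (g z) * / Cabs (g z)))
    as [th Hth].
  1, 2: intros z; pose proof (hpos z); apply cont_mult;
    [apply hg | apply cont_inv; [lra | apply cont_Cabs, hg]].
  { intros z; pose proof (hpos z); pose proof (Cabs_sqr (g z)) as Hs; unfold Cnorm2 in Hs.
    transitivity ((fst (g z) * fst (g z) + snd (g z) * snd (g z)) / (Cabs (g z) * Cabs (g z)));
      [field; lra | rewrite Hs; field; nra]. }
  exists (fun z => (ln (Cabs (g z)), th z)); split.
  - intros z; split; simpl; [|apply Hth].
    apply (cont_comp ln); [now apply continuity_pt_ln | apply cont_Cabs, hg].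
  - intros z; destruct (Hth z) as [_ [hcos hsin]]; pose proof (hpos z) as hp.
    fold (g z); unfold Cexp; simpl; rewrite exp_ln, hcos, hsin by exact hp.
    apply Cpx_ext; simpl; field; lra.
Qed.

(** The modulus of [c] fixes the real part; the imaginary part and a constant are two lifts of the
    same angle that agree at the origin. *)
Lemma Cexp_const_lift (psi : Cpx -> Cpx) (c : Cpx) :
  (forall z, Ccont psi z) -> (forall z, Cexp (psi z) = c) -> forall z, psi z = psi C0.
Proof.
  intros hc he z.
  assert (Hf : forall w, fst (psi w) = fst (psi C0)).
  { intros w; apply exp_inv; rewrite <- !Cabs_exp, !he; reflexivity. }
  apply Cpx_ext; [apply Hf|].
  replace z with (Cadd C0 z) by ring.
  apply (angle_lift_unique (fun w => snd (psi w)) (fun _ => snd (psi C0))); [|reflexivity].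
  intros t _ p; split; [apply hc|split; [apply cont_const|]].
  pose proof (he p) as Hp; rewrite <- (he C0) in Hp; unfold Cexp in Hp.
  rewrite Hf in Hp; injection Hp as Hcos Hsin; pose proof (exp_pos (fst (psi C0))).
  split; eapply Rmult_eq_reg_l; try eassumption; lra.
Qed.

(** * Quasi-periods of the lift *)

(** Under [Cexp], translation by [u] covers multiplication by [Cexp u]; thus a relation
    [h (l z) = m h z] becomes a quasi-period of the lift. *)
Definition quasi_period (F : Cpx -> Cpx) (u d : Cpx) : Prop :=
  forall z, F (Cadd z u) = Cadd (F z) d.

Lemma Ccont_translate (u z : Cpx) : Ccont (fun w => Cadd w u) z.
Proof.
  split; unfold Cadd; simpl; apply cont_plus; try apply cont_const;
    [apply cont_fst | apply cont_snd].
Qed.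

Lemma Ccont_sub (f g : Cpx -> Cpx) (z : Cpx) :
  Ccont f z -> Ccont g z -> Ccont (fun w => Csub (f w) (g w)) z.
Proof.
  intros [f1 f2] [g1 g2]; split; unfold Csub, Cadd, Copp; simpl;
    apply cont_plus; try assumption; now apply cont_opp.
Qed.

(** The increment [F (z + u) - F z] is a continuous logarithm of the constant [m], hence
    constant. *)
Lemma lift_quasi_period (h F : Cpx -> Cpx) (u m : Cpx) :
  (forall z, Ccont F z) -> (forall z, Cexp (F z) = h (Cexp z)) ->
  (forall z, z <> C0 -> h (Cmul (Cexp u) z) = Cmul m (h z)) ->
  exists d, Cexp d = m /\ quasi_period F u d.
Proof.
  intros hF hl heq.
  set (psi := fun z => Csub (F (Cadd z u)) (F z)).
  assert (he : forall z, Cexp (psi z) = m).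
  { intros z; apply Cexp_sub_eq; rewrite !hl, Cexp_add.
    rewrite <- heq by apply Cexp_neq0; f_equal; ring. }
  assert (hc : forall z, Ccont psi z).
  { intros z; apply Ccont_sub; [|apply hF].
    apply (Ccont_comp F (fun w => Cadd w u)); [apply Ccont_translate | apply hF]. }
  exists (psi C0); split; [apply he|]; intros z.
  rewrite <- (Cexp_const_lift psi m hc he z); unfold psi; ring.
Qed.

Lemma quasi_period_mul_Z (G : Cpx -> R) (u : Cpx) (d : R) :
  (forall z, G (Cadd z u) = G z + d) ->
  forall (k : Z) z, G (Cadd z (Cmul (RtoC (IZR k)) u)) = G z + IZR k * d.
Proof.
  intros H.
  assert (Hn : forall (n : nat) z, G (Cadd z (Cmul (RtoC (INR n)) u)) = G z + INR n * d).
  { induction n as [|n IH]; intros z.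
    - change (RtoC (INR 0)) with C0; replace (Cadd z (Cmul C0 u)) with z by ring; simpl; ring.
    - rewrite S_INR.
      replace (Cadd z (Cmul (RtoC (INR n + 1)) u))
        with (Cadd (Cadd z (Cmul (RtoC (INR n)) u)) u)
        by (apply Cpx_ext; unfold Cadd, Cmul, RtoC; simpl; ring).
      rewrite H, IH; ring. }
  intros k z; destruct (Z.le_gt_cases 0 k) as [hk|hk].
  - rewrite <- (Z2Nat.id k hk), <- INR_IZR_INZ; apply Hn.
  - pose proof (Hn (Z.to_nat (- k)) (Cadd z (Cmul (RtoC (IZR k)) u))) as E.
    rewrite INR_IZR_INZ, Z2Nat.id, opp_IZR in E by lia.
    replace (Cadd (Cadd z (Cmul (RtoC (IZR k)) u)) (Cmul (RtoC (- IZR k)) u)) with z in E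
      by (apply Cpx_ext; unfold Cadd, Cmul, RtoC; simpl; ring).
    lra.
Qed.

Lemma Int_part_frac_bounds (x : R) : Rabs (x - IZR (Int_part x)) <= 1.
Proof. destruct (base_Int_part x); apply Rabs_le; lra. Qed.

Lemma bounded_multiples_eq0 (x K : R) : (forall n : nat, INR n * Rabs x <= K) -> x = 0.
Proof.
  intros H; destruct (Req_dec x 0) as [h|h]; [exact h|exfalso].
  destruct (INR_archimed (Rabs x) K (Rabs_pos_lt x h)) as [n hn].
  specialize (H n); lra.
Qed.

Lemma Rabs_comb_le (s t x y : R) :
  Rabs s <= 1 -> Rabs t <= 1 -> Rabs (s * x + t * y) <= Rabs x + Rabs y.
Proof.
  intros hs ht; eapply Rle_trans; [apply Rabs_triang|]; rewrite !Rabs_mult.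
  pose proof (Rabs_pos x); pose proof (Rabs_pos y); nra.
Qed.

(* For every n the point n w - [n s] u - [n t] v stays in a fixed box, on which G is
   bounded, while G grows there by n (dw - s du - t dv) up to a bounded error. *)
Lemma quasi_period_linear (G : Cpx -> R) (u v w : Cpx) (du dv dw s t : R) :
  (forall z, cont G z) ->
  (forall z, G (Cadd z u) = G z + du) ->
  (forall z, G (Cadd z v) = G z + dv) ->
  (forall z, G (Cadd z w) = G z + dw) ->
  w = Cadd (Cmul (RtoC s) u) (Cmul (RtoC t) v) ->
  dw = s * du + t * dv.
Proof.
  intros hG hu hv hw Hw.
  set (M := Rabs (fst u) + Rabs (snd u) + Rabs (fst v) + Rabs (snd v)).
  destruct (cont_bounded_box G M hG) as [K HK].
  cut (dw - (s * du + t * dv) = 0); [lra|].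
  apply bounded_multiples_eq0 with (K := K + Rabs (G C0) + (Rabs du + Rabs dv)); intros n.
  set (a := Int_part (INR n * s)); set (b := Int_part (INR n * t)).
  pose proof (Int_part_frac_bounds (INR n * s)) as ha; fold a in ha.
  pose proof (Int_part_frac_bounds (INR n * t)) as hb; fold b in hb.
  set (fa := INR n * s - IZR a) in *; set (fb := INR n * t - IZR b) in *.
  set (p := Cadd (Cadd (Cadd C0 (Cmul (RtoC (IZR (Z.of_nat n))) w))
    (Cmul (RtoC (IZR (- a))) u)) (Cmul (RtoC (IZR (- b))) v)).
  assert (Hp : p = (fa * fst u + fb * fst v, fa * snd u + fb * snd v)).
  { unfold p, fa, fb; rewrite <- INR_IZR_INZ, !opp_IZR, Hw.
    apply Cpx_ext; unfold Cadd, Cmul, RtoC, C0; simpl; ring. }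
  assert (HGp : G p = G C0 + INR n * dw - IZR a * du - IZR b * dv).
  { unfold p; rewrite (quasi_period_mul_Z G v dv hv), (quasi_period_mul_Z G u du hu),
      (quasi_period_mul_Z G w dw hw), <- INR_IZR_INZ, !opp_IZR; ring. }
  assert (HB : Rabs (G p) <= K).
  { pose proof (Rabs_pos (fst u)); pose proof (Rabs_pos (snd u)).
    pose proof (Rabs_pos (fst v)); pose proof (Rabs_pos (snd v)).
    apply HK; rewrite Hp; simpl; (eapply Rle_trans; [now apply Rabs_comb_le|]);
      unfold M; lra. }
  rewrite <- (Rabs_pos_eq (INR n)) by apply pos_INR; rewrite <- Rabs_mult.
  replace (INR n * (dw - (s * du + t * dv)))
    with (G p - G C0 - (fa * du + fb * dv)) by (rewrite HGp; unfold fa, fb; ring).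
  pose proof (Rabs_comb_le fa fb du dv ha hb) as H1.
  pose proof (Rabs_triang (G p - G C0) (- (fa * du + fb * dv))) as H2.
  pose proof (Rabs_triang (G p) (- G C0)) as H3.
  rewrite Rabs_Ropp in H2, H3; unfold Rminus in *; lra.
Qed.

Lemma quasi_period_fst (F : Cpx -> Cpx) (u d : Cpx) :
  quasi_period F u d -> forall z, fst (F (Cadd z u)) = fst (F z) + fst d.
Proof. intros H z; rewrite (H z); reflexivity. Qed.

Lemma quasi_period_snd (F : Cpx -> Cpx) (u d : Cpx) :
  quasi_period F u d -> forall z, snd (F (Cadd z u)) = snd (F z) + snd d.
Proof. intros H z; rewrite (H z); reflexivity. Qed.

(** The integer [k] is the winding number about 0 of the image under [h] of a circle around 0. *)
Lemma lift_2PI (h F : Cpx -> Cpx) :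
  (forall z, Ccont F z) -> (forall z, Cexp (F z) = h (Cexp z)) ->
  exists k : Z, quasi_period F (0, 2 * PI) (0, 2 * PI * IZR k).
Proof.
  intros hF hl; destruct (lift_quasi_period h F (0, 2 * PI) C1 hF hl) as [d [hd Hd]].
  - intros z _; pose proof (Cexp_2PI 1) as E; rewrite Rmult_1_r in E; rewrite E.
    transitivity (h z); [f_equal; ring | ring].
  - destruct (Cexp_eq1 d hd) as [k ->]; now exists k.
Qed.

(** [F' (F z) - z] is a continuous logarithm of 1. The lifts are chosen independently, so a
    translation by [c] remains. *)
Lemma lift_inverse (h h' F F' : Cpx -> Cpx) :
  (forall z, Ccont F z) -> (forall z, Cexp (F z) = h (Cexp z)) ->
  (forall z, Ccont F' z) -> (forall z, Cexp (F' z) = h' (Cexp z)) ->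
  (forall z, z <> C0 -> h' (h z) = z) ->
  exists c, forall z, F' (F z) = Cadd z c.
Proof.
  intros hF hl hF' hl' hinv.
  set (psi := fun z => Csub (F' (F z)) z).
  assert (he : forall z, Cexp (psi z) = C1).
  { intros z; apply Cexp_sub_eq; rewrite hl', hl, hinv by apply Cexp_neq0; ring. }
  assert (hc : forall z, Ccont psi z).
  { intros z; apply Ccont_sub; [apply (Ccont_comp F' F); auto|].
    split; [apply cont_fst | apply cont_snd]. }
  exists (psi C0); intros z.
  rewrite <- (Cexp_const_lift psi C1 hc he z); unfold psi; ring.
Qed.

(** Winding numbers multiply under composition, and a translation has winding number 1; so
    [k k' = 1]. *)
Lemma winding_unit (F F' : Cpx -> Cpx) (c : Cpx) (k k' : Z) :
  quasi_period F (0, 2 * PI) (0, 2 * PI * IZR k) ->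
  quasi_period F' (0, 2 * PI) (0, 2 * PI * IZR k') ->
  (forall z, F' (F z) = Cadd z c) ->
  k = 1%Z \/ k = (-1)%Z.
Proof.
  intros hk hk' hc.
  assert (H : (k * k' = 1)%Z).
  { pose proof (quasi_period_mul_Z (fun z => snd (F' z)) _ _ (quasi_period_snd _ _ _ hk') k
      (F C0)) as H.
    replace (Cmul (RtoC (IZR k)) (0, 2 * PI)) with ((0, 2 * PI * IZR k) : Cpx) in H
      by (apply Cpx_ext; unfold Cmul, RtoC; simpl; ring).
    cbv beta in H; rewrite <- hk, !hc in H; unfold Cadd, C0 in H; simpl in H.
    pose proof PI_RGT_0; apply eq_IZR; rewrite mult_IZR.
    apply Rmult_eq_reg_l with (2 * PI); lra. }
  exact (Z.eq_mul_1 _ _ H).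
Qed.

Lemma quasi_period_inverse (F F' : Cpx -> Cpx) (c c' u d : Cpx) :
  (forall z, F' (F z) = Cadd z c) -> (forall z, F (F' z) = Cadd z c') ->
  quasi_period F u d -> quasi_period F' d u.
Proof.
  intros hc hc' H z.
  assert (Hz : z = F (F' (Csub z c'))) by (rewrite hc'; ring).
  rewrite Hz, <- H, !hc; ring.
Qed.

Lemma quasi_period_vertical (F : Cpx -> Cpx) (k : Z) (u d : Cpx) :
  (forall z, Ccont F z) -> quasi_period F (0, 2 * PI) (0, 2 * PI * IZR k) ->
  quasi_period F u d -> fst u = 0 -> d = (0, IZR k * snd u).
Proof.
  intros hF hk H hu; pose proof PI_RGT_0.
  (* [quasi_period_linear] expects two directions; [2 pi i] is supplied twice, the first time with
     weight 0. *)
  assert (Hu : u = Cadd (Cmul (RtoC 0) (0, 2 * PI)) (Cmul (RtoC (snd u / (2 * PI))) (0, 2 * PI))).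
  { apply Cpx_ext; unfold Cadd, Cmul, RtoC; simpl; [rewrite hu; ring | field; lra]. }
  apply Cpx_ext.
  - rewrite (quasi_period_linear (fun z => fst (F z)) _ _ u 0 0 (fst d) _ _
      (fun z => proj1 (hF z)) (quasi_period_fst _ _ _ hk) (quasi_period_fst _ _ _ hk)
      (quasi_period_fst _ _ _ H) Hu); simpl; ring.
  - rewrite (quasi_period_linear (fun z => snd (F z)) _ _ u (2 * PI * IZR k) (2 * PI * IZR k)
      (snd d) _ _
      (fun z => proj2 (hF z)) (quasi_period_snd _ _ _ hk) (quasi_period_snd _ _ _ hk)
      (quasi_period_snd _ _ _ H) Hu); simpl; field; lra.
Qed.

(** A quasi-period with nonzero real part forms, together with [2 pi i], a real basis of the plane,
    and [quasi_period_linear] expresses every other one through these two. *)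
Lemma quasi_period_map_linear (F F' : Cpx -> Cpx) (c c' : Cpx) (k k' : Z) :
  (forall z, Ccont F z) -> (forall z, Ccont F' z) ->
  quasi_period F (0, 2 * PI) (0, 2 * PI * IZR k) ->
  quasi_period F' (0, 2 * PI) (0, 2 * PI * IZR k') ->
  (forall z, F' (F z) = Cadd z c) -> (forall z, F (F' z) = Cadd z c') ->
  exists a b, a <> 0 /\ forall u d, quasi_period F u d ->
    d = (a * fst u, b * fst u + IZR k * snd u).
Proof.
  intros hF hF' hk hk' hc hc'; pose proof PI_RGT_0 as hpi.
  destruct (classic (exists u d, quasi_period F u d /\ fst u <> 0)) as [[u [d [H hu]]]|Hno].
  (* The two witnesses are solved from [d = (a x, b x + k y)] at this one [u = (x, y)]. *)
  - exists (fst d / fst u), ((snd d - IZR k * snd u) / fst u); split.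
    (* If [a] were 0, [d] would be vertical; as [F'] carries the quasi-period [d] back to [u], then
       [u] would be vertical as well. *)
    + intros h0; apply hu.
      assert (hd : fst d = 0)
        by (replace (fst d) with (fst d / fst u * fst u) by (field; exact hu); rewrite h0; ring).
      pose proof (quasi_period_inverse F F' c c' u d hc hc' H) as H'.
      now rewrite (quasi_period_vertical F' k' d u hF' hk' H' hd).
    + intros w e Hw.
      set (s := fst w / fst u); set (t := (snd w - s * snd u) / (2 * PI)).
      assert (Ew : w = Cadd (Cmul (RtoC s) u) (Cmul (RtoC t) (0, 2 * PI))).
      { apply Cpx_ext; unfold Cadd, Cmul, RtoC, t, s; simpl; field; repeat split; lra. }
      apply Cpx_ext.
      * rewrite (quasi_period_linear (fun z => fst (F z)) u _ w (fst d) 0 (fst e) s t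
          (fun z => proj1 (hF z)) (quasi_period_fst _ _ _ H) (quasi_period_fst _ _ _ hk)
          (quasi_period_fst _ _ _ Hw) Ew); unfold s; simpl; field; exact hu.
      * rewrite (quasi_period_linear (fun z => snd (F z)) u _ w (snd d) (2 * PI * IZR k)
          (snd e) s t
          (fun z => proj2 (hF z)) (quasi_period_snd _ _ _ H) (quasi_period_snd _ _ _ hk)
          (quasi_period_snd _ _ _ Hw) Ew); unfold t, s; simpl; field; repeat split; lra.
  (* All quasi-periods are vertical, so [a] and [b] are multiplied by 0 and any nonzero [a] will
     do. *)
  - exists 1, 0; split; [lra|]; intros u d H'.
    destruct (Req_dec (fst u) 0) as [hu|hu]; [|exfalso; apply Hno; now exists u, d].
    rewrite (quasi_period_vertical F k u d hF hk H' hu), hu; f_equal; ring.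
Qed.

Lemma Cconj_exp (u : Cpx) : Cconj (Cexp u) = Cexp (Cconj u).
Proof. unfold Cconj, Cexp; simpl; rewrite cos_neg, sin_neg; f_equal; ring. Qed.

Lemma Rcpow_exp (x : R) (alpha : Cpx) : Rcpow (exp x) alpha = Cexp (Cmul alpha (RtoC x)).
Proof. unfold Rcpow; now rewrite ln_exp. Qed.

(** The pairs [l], [m] are quantified after [alpha]: the exponent depends on the maps only, through
    their lifts. *)
Lemma equivariant_multipliers (h h' : Cpx -> Cpx) :
  (forall z, z <> C0 -> h z <> C0) -> (forall z, z <> C0 -> h' z <> C0) ->
  (forall z, z <> C0 -> Ccont h z) -> (forall z, z <> C0 -> Ccont h' z) ->
  (forall z, z <> C0 -> h' (h z) = z) -> (forall z, z <> C0 -> h (h' z) = z) ->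
  let equiv l m := forall z, z <> C0 -> h (Cmul l z) = Cmul m (h z) in
  exists alpha, Re alpha <> -1 /\
    ((forall l m, l <> C0 -> equiv l m -> m = Cmul l (Rcpow (Cabs l) alpha)) \/
     (forall l m, l <> C0 -> equiv l m -> m = Cmul (Cconj l) (Rcpow (Cabs l) alpha))).
Proof.
  intros nz nz' hc hc' i1 i2 equiv.
  destruct (exp_lift h nz hc) as [F [hF hl]]; destruct (exp_lift h' nz' hc') as [F' [hF' hl']].
  destruct (lift_2PI h F hF hl) as [k hk]; destruct (lift_2PI h' F' hF' hl') as [k' hk'].
  destruct (lift_inverse h h' F F' hF hl hF' hl' i1) as [c Hc].
  destruct (lift_inverse h' h F' F hF' hl' hF hl i2) as [c' Hc'].
  destruct (quasi_period_map_linear F F' c c' k k' hF hF' hk hk' Hc Hc') as [a [b [ha Hab]]].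
  assert (Hm : forall l m, l <> C0 -> equiv l m -> exists u,
    l = Cexp u /\ m = Cexp (a * fst u, b * fst u + IZR k * snd u)).
  { intros l m hl0 heq; destruct (Cexp_surj l hl0) as [u <-]; exists u; split; [reflexivity|].
    destruct (lift_quasi_period h F u m hF hl heq) as [d [<- Hd]].
    f_equal; now apply Hab. }
  (* With [l = exp (x + i y)], the factor [l] or its conjugate already contributes [x + i y] or
     [x - i y] to the exponent; [|l|^alpha] must supply the rest, [(a - 1) x + i b x]. *)
  exists (a - 1, b); split; [unfold Re; simpl; lra|].
  destruct (winding_unit F F' c k k' hk hk' Hc) as [->| ->]; [left|right].
  - intros l m hl0 heq; destruct (Hm l m hl0 heq) as [u [-> ->]].
    rewrite Cabs_exp, Rcpow_exp, <- Cexp_add; f_equal.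
    apply Cpx_ext; unfold Cadd, Cmul, RtoC; simpl; ring.
  - intros l m hl0 heq; destruct (Hm l m hl0 heq) as [u [-> ->]].
    rewrite Cabs_exp, Rcpow_exp, Cconj_exp, <- Cexp_add; f_equal.
    apply Cpx_ext; unfold Cadd, Cmul, RtoC, Cconj; simpl; ring.
Qed.

(** * Moebius transformations and the chordal metric *)

(** Homogeneous coordinates treat infinity like any other point: the action becomes linear, and case
    distinctions are confined to the normalization [vec_CP1]. *)
Definition CP1_vec (x : CP1) : Cpx * Cpx :=
  match x with Some z => (z, C1) | None => (C1, C0) end.

Definition vec_CP1 (w : Cpx * Cpx) : CP1 :=
  if Ceq_dec (snd w) C0 then None else Some (Cdiv (fst w) (snd w)).

Definition vscale (k : Cpx) (w : Cpx * Cpx) : Cpx * Cpx := (Cmul k (fst w), Cmul k (snd w)).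

Definition mvec (M : mat2) (w : Cpx * Cpx) : Cpx * Cpx :=
  (Cadd (Cmul (m11 M) (fst w)) (Cmul (m12 M) (snd w)),
   Cadd (Cmul (m21 M) (fst w)) (Cmul (m22 M) (snd w))).

Definition wedge (v w : Cpx * Cpx) : Cpx :=
  Csub (Cmul (fst v) (snd w)) (Cmul (snd v) (fst w)).

Definition vnorm2 (w : Cpx * Cpx) : R := Cnorm2 (fst w) + Cnorm2 (snd w).

Lemma Cnorm2_C0 : Cnorm2 C0 = 0.
Proof. unfold Cnorm2, C0; simpl; ring. Qed.

Lemma Cnorm2_C1 : Cnorm2 C1 = 1.
Proof. unfold Cnorm2, C1; simpl; ring. Qed.

Lemma CP1_vec_pos (x : CP1) : 0 < vnorm2 (CP1_vec x).
Proof.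
  destruct x as [z|]; unfold vnorm2; simpl; rewrite Cnorm2_C1; [|rewrite Cnorm2_C0; lra].
  pose proof (Cnorm2_ge0 z); lra.
Qed.

Lemma vnorm2_scale (k : Cpx) (w : Cpx * Cpx) : vnorm2 (vscale k w) = Cnorm2 k * vnorm2 w.
Proof. unfold vnorm2, vscale; simpl; rewrite !Cnorm2_mul; ring. Qed.

Lemma wedge_scale (k l : Cpx) (v w : Cpx * Cpx) :
  wedge (vscale k v) (vscale l w) = Cmul (Cmul k l) (wedge v w).
Proof. unfold wedge, vscale; simpl; ring. Qed.

Lemma mvec_scale (M : mat2) (k : Cpx) (w : Cpx * Cpx) :
  mvec M (vscale k w) = vscale k (mvec M w).
Proof. unfold mvec, vscale; cbn [fst snd]; f_equal; ring. Qed.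

Lemma mvec_mul (M N : mat2) (w : Cpx * Cpx) : mvec (mmul M N) w = mvec M (mvec N w).
Proof.
  unfold mvec, mmul; unfold m11, m12, m21, m22; cbn [fst snd]; f_equal; ring.
Qed.

Lemma wedge_mvec (M : mat2) (v w : Cpx * Cpx) :
  wedge (mvec M v) (mvec M w) = Cmul (mdet M) (wedge v w).
Proof. unfold wedge, mvec, mdet; cbn [fst snd]; ring. Qed.

Lemma vec_CP1_scale (k : Cpx) (w : Cpx * Cpx) : k <> C0 -> vec_CP1 (vscale k w) = vec_CP1 w.
Proof.
  intros hk; unfold vec_CP1, vscale; cbn [fst snd].
  destruct (Ceq_dec (snd w) C0) as [h|h].
  - rewrite h; destruct (Ceq_dec (Cmul k C0) C0) as [_|H]; [reflexivity|exfalso; apply H; ring].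
  - destruct (Ceq_dec (Cmul k (snd w)) C0) as [H|_]; [now apply Cmul_neq0 in H|].
    f_equal; field; now split.
Qed.

Lemma vec_CP1_repr (w : Cpx * Cpx) :
  0 < vnorm2 w -> exists k, k <> C0 /\ w = vscale k (CP1_vec (vec_CP1 w)).
Proof.
  intros hw; unfold vec_CP1; destruct w as [a b]; cbn [fst snd].
  destruct (Ceq_dec b C0) as [->|h].
  - exists a; split; [|unfold vscale; simpl; f_equal; ring].
    intros ->; unfold vnorm2 in hw; simpl in hw; rewrite Cnorm2_C0 in hw; lra.
  - exists b; split; [exact h|]; unfold vscale; cbn [CP1_vec fst snd]; f_equal; field; exact h.
Qed.

Lemma pact_mvec (M : mat2) (x : CP1) : pact M x = vec_CP1 (mvec M (CP1_vec x)).
Proof.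
  unfold vec_CP1, mvec; destruct x as [z|]; unfold pact, CP1_vec; cbn [fst snd].
  - replace (Cmul (m12 M) C1) with (m12 M) by ring.
    replace (Cmul (m22 M) C1) with (m22 M) by ring; reflexivity.
  - replace (Cadd (Cmul (m11 M) C1) (Cmul (m12 M) C0)) with (m11 M) by ring.
    replace (Cadd (Cmul (m21 M) C1) (Cmul (m22 M) C0)) with (m21 M) by ring; reflexivity.
Qed.

Lemma mdet_mul (M N : mat2) : mdet (mmul M N) = Cmul (mdet M) (mdet N).
Proof. unfold mdet, mmul, m11, m12, m21, m22; cbn [fst snd]; ring. Qed.

Lemma mmul_minv_l (M : mat2) : mdet M <> C0 -> mmul (minv M) M = diag2 C1 C1.
Proof.
  intros h; assert (h' := h); unfold mdet in h'.
  unfold mmul, minv, diag2; unfold m11, m12, m21, m22 in *; cbn [fst snd].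
  unfold mdet, m11, m12, m21, m22; f_equal; f_equal; field; exact h'.
Qed.

Lemma mmul_minv_r (M : mat2) : mdet M <> C0 -> mmul M (minv M) = diag2 C1 C1.
Proof.
  intros h; assert (h' := h); unfold mdet in h'.
  unfold mmul, minv, diag2; unfold m11, m12, m21, m22 in *; cbn [fst snd].
  unfold mdet, m11, m12, m21, m22; f_equal; f_equal; field; exact h'.
Qed.

Lemma mdet_diag2 (a b : Cpx) : mdet (diag2 a b) = Cmul a b.
Proof. unfold mdet, diag2, m11, m12, m21, m22; cbn [fst snd]; ring. Qed.

Lemma mdet_minv (M : mat2) : mdet M <> C0 -> mdet (minv M) <> C0.
Proof.
  intros h H; apply C1_neq0; transitivity (mdet (mmul (minv M) M)).
  - rewrite mmul_minv_l, mdet_diag2 by exact h; ring.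
  - rewrite mdet_mul, H; ring.
Qed.

Lemma mvec_id (w : Cpx * Cpx) : mvec (diag2 C1 C1) w = w.
Proof.
  destruct w; unfold mvec, diag2, m11, m12, m21, m22; cbn [fst snd]; f_equal; ring.
Qed.

Lemma Cnorm2_lincomb_le (a b u v : Cpx) :
  Cnorm2 (Cadd (Cmul a u) (Cmul b v)) <= 2 * (Cnorm2 a + Cnorm2 b) * (Cnorm2 u + Cnorm2 v).
Proof.
  assert (H : forall z w, Cnorm2 (Cadd z w) <= 2 * (Cnorm2 z + Cnorm2 w)).
  { intros [z1 z2] [w1 w2]; unfold Cnorm2, Cadd; simpl.
    pose proof (Rle_0_sqr (z1 - w1)); pose proof (Rle_0_sqr (z2 - w2)); unfold Rsqr in *; lra. }
  eapply Rle_trans; [apply H|]; rewrite !Cnorm2_mul.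
  pose proof (Cnorm2_ge0 a); pose proof (Cnorm2_ge0 b).
  pose proof (Cnorm2_ge0 u); pose proof (Cnorm2_ge0 v); nra.
Qed.

(** Twice the squared Frobenius norm; the factor 2 comes from [|z + w|^2 <= 2 (|z|^2 + |w|^2)]. *)
Definition mnorm2 (M : mat2) : R :=
  2 * (Cnorm2 (m11 M) + Cnorm2 (m12 M) + (Cnorm2 (m21 M) + Cnorm2 (m22 M))).

Lemma vnorm2_mvec_le (M : mat2) (w : Cpx * Cpx) : vnorm2 (mvec M w) <= mnorm2 M * vnorm2 w.
Proof.
  unfold vnorm2 at 1, mvec, mnorm2; cbn [fst snd].
  pose proof (Cnorm2_lincomb_le (m11 M) (m12 M) (fst w) (snd w)).
  pose proof (Cnorm2_lincomb_le (m21 M) (m22 M) (fst w) (snd w)).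
  unfold vnorm2; lra.
Qed.

Lemma vnorm2_le_mvec (M : mat2) (w : Cpx * Cpx) :
  mdet M <> C0 -> vnorm2 w <= mnorm2 (minv M) * vnorm2 (mvec M w).
Proof.
  intros h; rewrite <- (mvec_id w) at 1; rewrite <- (mmul_minv_l M h), mvec_mul.
  apply vnorm2_mvec_le.
Qed.

Lemma mvec_pos (M : mat2) (x : CP1) : mdet M <> C0 -> 0 < vnorm2 (mvec M (CP1_vec x)).
Proof.
  intros h; pose proof (CP1_vec_pos x) as h1.
  pose proof (vnorm2_le_mvec M (CP1_vec x) h) as h2.
  assert (h3 : 0 <= vnorm2 (mvec M (CP1_vec x)))
    by (apply Rplus_le_le_0_compat; apply Cnorm2_ge0).
  destruct h3 as [h3|h3]; [exact h3|]; rewrite <- h3 in h2; lra.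
Qed.

Lemma pact_mul (M N : mat2) (x : CP1) :
  mdet N <> C0 -> pact (mmul M N) x = pact M (pact N x).
Proof.
  intros h; rewrite !pact_mvec, mvec_mul.
  destruct (vec_CP1_repr _ (mvec_pos N x h)) as [k [hk Hk]].
  rewrite Hk at 1; rewrite mvec_scale; now apply vec_CP1_scale.
Qed.

Definition CP1_mul (l : Cpx) (x : CP1) : CP1 := option_map (Cmul l) x.

Lemma pact_diag2 (a b : Cpx) (x : CP1) :
  b <> C0 -> pact (diag2 a b) x = CP1_mul (Cdiv a b) x.
Proof.
  intros hb; unfold pact, diag2, m11, m12, m21, m22; destruct x as [z|]; cbn [fst snd].
  - replace (Cadd (Cmul C0 z) b) with b by ring.
    destruct (Ceq_dec b C0) as [h|_]; [contradiction|].
    simpl; f_equal; field; exact hb.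
  - destruct (Ceq_dec C0 C0) as [_|h]; [reflexivity | contradiction].
Qed.

Lemma CP1_mul_1 (x : CP1) : CP1_mul C1 x = x.
Proof. destruct x; simpl; f_equal; ring. Qed.

Lemma pact_id (x : CP1) : pact (diag2 C1 C1) x = x.
Proof.
  rewrite pact_diag2 by apply C1_neq0.
  replace (Cdiv C1 C1) with C1 by (field; apply C1_neq0); apply CP1_mul_1.
Qed.

Lemma pact_minv_l (M : mat2) (x : CP1) : mdet M <> C0 -> pact (minv M) (pact M x) = x.
Proof. intros h; rewrite <- pact_mul, mmul_minv_l by exact h; apply pact_id. Qed.

Lemma pact_minv_r (M : mat2) (x : CP1) : mdet M <> C0 -> pact M (pact (minv M) x) = x.
Proof.
  intros h; rewrite <- pact_mul, mmul_minv_r by now try apply mdet_minv.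
  apply pact_id.
Qed.

Lemma pact_conj_diag (M : mat2) (a b : Cpx) (x : CP1) :
  mdet M <> C0 -> a <> C0 -> b <> C0 ->
  pact (mmul M (mmul (diag2 a b) (minv M))) x = pact M (CP1_mul (Cdiv a b) (pact (minv M) x)).
Proof.
  intros h ha hb; rewrite pact_mul, pact_mul, pact_diag2; try assumption.
  - reflexivity.
  - now apply mdet_minv.
  - rewrite mdet_mul, mdet_diag2; repeat apply Cmul_neq0; try assumption; now apply mdet_minv.
Qed.

(** * Chordal metric and continuity on the sphere *)

Lemma chordal_ge0 (x y : CP1) : 0 <= chordal x y.
Proof.
  destruct x as [z|], y as [w|]; unfold chordal.
  - pose proof (Cnorm2_ge0 z); pose proof (Cnorm2_ge0 w).
    apply Rdiv_le_0_compat; [pose proof (Cabs_ge0 (Csub z w)); lra|].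
    apply sqrt_lt_R0; nra.
  - pose proof (Cnorm2_ge0 z); apply Rdiv_le_0_compat; [lra|]; apply sqrt_lt_R0; lra.
  - pose proof (Cnorm2_ge0 w); apply Rdiv_le_0_compat; [lra|]; apply sqrt_lt_R0; lra.
  - lra.
Qed.

Lemma div_sqrt_sqr (a b : R) : 0 < b -> (a / sqrt b) ^ 2 = a ^ 2 / b.
Proof.
  intros hb; pose proof (sqrt_lt_R0 b hb); pose proof (sqrt_sqrt b (Rlt_le _ _ hb)) as H1.
  replace (a ^ 2 / b) with (a ^ 2 / (sqrt b * sqrt b)) by now rewrite H1.
  field; lra.
Qed.

(** One formula for all four cases of [chordal]. The quotient does not change when either vector is
    rescaled, and squaring removes the roots. *)
Lemma chordal_sqr (x y : CP1) :
  chordal x y ^ 2 =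
  4 * Cnorm2 (wedge (CP1_vec x) (CP1_vec y)) / (vnorm2 (CP1_vec x) * vnorm2 (CP1_vec y)).
Proof.
  destruct x as [z|], y as [w|]; unfold chordal, wedge, vnorm2, CP1_vec; cbn [fst snd];
    rewrite ?Cnorm2_C0, ?Cnorm2_C1.
  - pose proof (Cnorm2_ge0 z); pose proof (Cnorm2_ge0 w).
    rewrite div_sqrt_sqr by nra; rewrite Rpow_mult_distr, <- (Rsqr_pow2 (Cabs _)).
    unfold Rsqr; rewrite Cabs_sqr.
    replace (Csub (Cmul z C1) (Cmul C1 w)) with (Csub z w) by ring.
    field; nra.
  - pose proof (Cnorm2_ge0 z); rewrite div_sqrt_sqr by lra.
    replace (Csub (Cmul z C0) (Cmul C1 C1)) with (Copp C1) by ring.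
    replace (Cnorm2 (Copp C1)) with 1 by (unfold Cnorm2, Copp, C1; simpl; ring).
    field; nra.
  - pose proof (Cnorm2_ge0 w); rewrite div_sqrt_sqr by lra.
    replace (Csub (Cmul C1 C1) (Cmul C0 w)) with C1 by ring.
    rewrite Cnorm2_C1; field; nra.
  - replace (Csub (Cmul C1 C0) (Cmul C0 C1)) with C0 by ring.
    rewrite Cnorm2_C0; field.
Qed.

Definition CP1_cont_at (f : CP1 -> CP1) (x : CP1) : Prop :=
  forall eps, 0 < eps -> exists delta, 0 < delta /\
    forall y, chordal x y < delta -> chordal (f x) (f y) < eps.

Lemma CP1_cont_at_comp (f g : CP1 -> CP1) (x : CP1) :
  CP1_cont_at f x -> CP1_cont_at g (f x) -> CP1_cont_at (fun y => g (f y)) x.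
Proof.
  intros hf hg eps he; destruct (hg eps he) as [d [hd Hd]]; destruct (hf d hd) as [d' [hd' Hd']].
  exists d'; auto.
Qed.

Lemma continuous_CP1_lipschitz (f : CP1 -> CP1) (K : R) :
  (forall x y, chordal (f x) (f y) ^ 2 <= K * chordal x y ^ 2) -> continuous_CP1 f.
Proof.
  (* This [K'] is positive and satisfies [K <= K'^2] for every real [K], so it serves as a Lipschitz
     constant for the unsquared distance. *)
  intros H x eps he; set (K' := 1 + Rabs K).
  pose proof (Rle_abs K); pose proof (Rabs_pos K).
  exists (eps / K'); split; [apply Rdiv_lt_0_compat; unfold K'; lra|]; intros y hy.
  apply Rlt_div_r in hy; [|unfold K'; lra].
  specialize (H x y); pose proof (chordal_ge0 x y) as h0; pose proof (chordal_ge0 (f x) (f y)).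
  apply Rnot_le_lt; intros hge.
  assert (h1 : chordal x y * K' * (chordal x y * K') < eps * eps)
    by (apply Rmult_le_0_lt_compat; try assumption; unfold K'; nra).
  assert (h2 : K * chordal x y ^ 2 <= chordal x y * K' * (chordal x y * K')).
  { replace (chordal x y * K' * (chordal x y * K')) with (K' * K' * chordal x y ^ 2) by ring.
    apply Rmult_le_compat_r; [apply pow2_ge_0 | unfold K'; nra]. }
  nra.
Qed.

(** [M] multiplies [wedge] exactly by its determinant and shrinks squared norms at most by the
    factor [mnorm2 (minv M)], so it is Lipschitz for the chordal metric. *)
Lemma continuous_CP1_pact (M : mat2) : mdet M <> C0 -> continuous_CP1 (pact M).
Proof.
  intros h; apply continuous_CP1_lipschitz
    with (K := Cnorm2 (mdet M) * (mnorm2 (minv M) * mnorm2 (minv M))).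
  intros x y; rewrite !chordal_sqr, !pact_mvec.
  destruct (vec_CP1_repr _ (mvec_pos M x h)) as [k [hk Hk]].
  destruct (vec_CP1_repr _ (mvec_pos M y h)) as [l [hl Hl]].
  pose proof (Cnorm2_gt0 k hk) as nk; pose proof (Cnorm2_gt0 l hl) as nl.
  pose proof (wedge_mvec M (CP1_vec x) (CP1_vec y)) as Hw.
  pose proof (vnorm2_le_mvec M (CP1_vec x) h) as Bx.
  pose proof (vnorm2_le_mvec M (CP1_vec y) h) as By.
  pose proof (mvec_pos M x h) as Px; pose proof (mvec_pos M y h) as Py.
  set (a := CP1_vec (vec_CP1 (mvec M (CP1_vec x)))) in *.
  set (b := CP1_vec (vec_CP1 (mvec M (CP1_vec y)))) in *.
  pose proof (CP1_vec_pos (vec_CP1 (mvec M (CP1_vec x)))) as pa; fold a in pa.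
  pose proof (CP1_vec_pos (vec_CP1 (mvec M (CP1_vec y)))) as pb; fold b in pb.
  pose proof (CP1_vec_pos x) as px; pose proof (CP1_vec_pos y) as py.
  set (v := CP1_vec x) in *; set (w := CP1_vec y) in *.
  (* By scale invariance the normalized representatives [a], [b] may be replaced by the image
     vectors [M v], [M w]. *)
  assert (E : Cnorm2 (wedge a b) / (vnorm2 a * vnorm2 b) =
    Cnorm2 (mdet M) * Cnorm2 (wedge v w) / (vnorm2 (mvec M v) * vnorm2 (mvec M w))).
  { rewrite <- Cnorm2_mul, <- Hw, Hk, Hl, wedge_scale, !vnorm2_scale, !Cnorm2_mul.
    field; lra. }
  clear Hk Hl Hw; clearbody a b.
  set (va := vnorm2 (mvec M v)) in *; set (vb := vnorm2 (mvec M w)) in *.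
  set (C := mnorm2 (minv M)) in *; set (D := Cnorm2 (mdet M)) in *.
  pose proof (Cnorm2_ge0 (wedge v w)) as W; set (n := Cnorm2 (wedge v w)) in *.
  assert (HD : 0 <= D) by apply Cnorm2_ge0.
  replace (4 * Cnorm2 (wedge a b) / (vnorm2 a * vnorm2 b))
    with (4 * (Cnorm2 (wedge a b) / (vnorm2 a * vnorm2 b))) by (field; lra).
  rewrite E.
  assert (Hb : vnorm2 v * vnorm2 w <= C * va * (C * vb)).
  { apply Rmult_le_compat; lra. }
  assert (Hi : / (va * vb) <= C * C * / (vnorm2 v * vnorm2 w)).
  { assert (p1 : 0 < va * vb) by nra; assert (p2 : 0 < vnorm2 v * vnorm2 w) by nra.
    apply Rmult_le_reg_r with (va * vb); [exact p1|].
    rewrite Rinv_l by lra.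
    apply Rmult_le_reg_r with (vnorm2 v * vnorm2 w); [exact p2|].
    replace (C * C * / (vnorm2 v * vnorm2 w) * (va * vb) * (vnorm2 v * vnorm2 w))
      with (C * va * (C * vb)) by (field; lra).
    lra. }
  assert (HDn : 0 <= 4 * (D * n)) by nra.
  unfold Rdiv.
  replace (4 * (D * n * / (va * vb))) with (4 * (D * n) * / (va * vb)) by ring.
  replace (D * (C * C) * (4 * n * / (vnorm2 v * vnorm2 w)))
    with (4 * (D * n) * (C * C * / (vnorm2 v * vnorm2 w))) by ring.
  now apply Rmult_le_compat_l.
Qed.

Lemma homeomorphism_CP1_pact (M : mat2) : mdet M <> C0 -> homeomorphism_CP1 (pact M).
Proof.
  intros h; exists (pact (minv M)); repeat split.
  - intros x; now apply pact_minv_l.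
  - intros x; now apply pact_minv_r.
  - now apply continuous_CP1_pact.
  - now apply continuous_CP1_pact, mdet_minv.
Qed.

Lemma homeomorphism_CP1_comp (f g : CP1 -> CP1) :
  homeomorphism_CP1 f -> homeomorphism_CP1 g -> homeomorphism_CP1 (fun x => g (f x)).
Proof.
  intros [f' [f1 [f2 [f3 f4]]]] [g' [g1 [g2 [g3 g4]]]].
  exists (fun x => f' (g' x)); repeat split.
  - intros x; now rewrite g1, f1.
  - intros x; now rewrite f2, g2.
  - intros x; apply (CP1_cont_at_comp f g); [exact (f3 x) | exact (g3 _)].
  - intros x; apply (CP1_cont_at_comp g' f'); [exact (g4 x) | exact (f4 _)].
Qed.

Lemma sqrt_1_Cnorm2_le (z : Cpx) : 1 <= sqrt (1 + Cnorm2 z) <= 1 + Cabs z.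
Proof.
  pose proof (Cabs_ge0 z); pose proof (Cabs_sqr z); pose proof (Cnorm2_ge0 z); split.
  - rewrite <- sqrt_1 at 1; apply sqrt_le_1_alt; lra.
  - rewrite <- (sqrt_square (1 + Cabs z)) by lra; apply sqrt_le_1_alt; nra.
Qed.

Lemma chordal_le_Cabs (z w : Cpx) : chordal (Some z) (Some w) <= 2 * Cabs (Csub w z).
Proof.
  unfold chordal; pose proof (Cnorm2_ge0 z); pose proof (Cnorm2_ge0 w).
  replace (Cabs (Csub z w)) with (Cabs (Csub w z))
    by (unfold Cabs, Cnorm2, Csub, Cadd, Copp; simpl; f_equal; ring).
  rewrite sqrt_mult by lra.
  pose proof (sqrt_1_Cnorm2_le z); pose proof (sqrt_1_Cnorm2_le w).
  pose proof (Cabs_ge0 (Csub w z)).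
  apply Rle_div_l; [nra|].
  assert (1 <= sqrt (1 + Cnorm2 z) * sqrt (1 + Cnorm2 w)) by nra.
  nra.
Qed.

(** With [x] the chordal distance, [B = 1 + |z|] and [D = |w - z|], one has [2 D <= x B (B + D)].
    Since [x B <= 1], the term [x B D] is absorbed on the left, leaving [D <= x B^2]. *)
Lemma Cabs_le_chordal (z w : Cpx) :
  chordal (Some z) (Some w) * (1 + Cabs z) <= 1 ->
  Cabs (Csub w z) <= chordal (Some z) (Some w) * (1 + Cabs z) * (1 + Cabs z).
Proof.
  pose proof (chordal_ge0 (Some z) (Some w)) as hx.
  assert (E : 2 * Cabs (Csub w z) =
    chordal (Some z) (Some w) * (sqrt (1 + Cnorm2 z) * sqrt (1 + Cnorm2 w))).
  { unfold chordal; pose proof (Cnorm2_ge0 z); pose proof (Cnorm2_ge0 w).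
    replace (Cabs (Csub w z)) with (Cabs (Csub z w))
      by (unfold Cabs, Cnorm2, Csub, Cadd, Copp; simpl; f_equal; ring).
    pose proof (sqrt_1_Cnorm2_le z); pose proof (sqrt_1_Cnorm2_le w).
    rewrite sqrt_mult by lra; field; lra. }
  set (x := chordal (Some z) (Some w)) in *; intros hB.
  pose proof (sqrt_1_Cnorm2_le z) as hz; pose proof (sqrt_1_Cnorm2_le w) as hw.
  pose proof (Cabs_ge0 z); pose proof (Cabs_ge0 (Csub w z)).
  pose proof (Cabs_add_le (Csub w z) z) as ht.
  replace (Cadd (Csub w z) z) with w in ht by ring.
  assert (h1 : sqrt (1 + Cnorm2 z) * sqrt (1 + Cnorm2 w) <=
    (1 + Cabs z) * (1 + Cabs z + Cabs (Csub w z))).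
  { apply Rmult_le_compat; lra. }
  assert (h2 : 2 * Cabs (Csub w z) <= x * ((1 + Cabs z) * (1 + Cabs z + Cabs (Csub w z)))).
  { rewrite E; now apply Rmult_le_compat_l. }
  assert (h3 : x * (1 + Cabs z) * Cabs (Csub w z) <= 1 * Cabs (Csub w z))
    by now apply Rmult_le_compat_r.
  lra.
Qed.

(** Points of chordal distance below [1 / (1 + |z|)] from [z] are therefore finite. *)
Lemma chordal_None_ge (z : Cpx) : 1 <= chordal (Some z) None * (1 + Cabs z).
Proof.
  unfold chordal; pose proof (sqrt_1_Cnorm2_le z) as hz.
  replace (2 / sqrt (1 + Cnorm2 z) * (1 + Cabs z))
    with (2 * (1 + Cabs z) / sqrt (1 + Cnorm2 z)) by (field; lra).
  apply Rle_div_r; lra.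
Qed.

Lemma Ccont_eps (h : Cpx -> Cpx) (z : Cpx) :
  Ccont h z <->
  forall eps, 0 < eps -> exists d, 0 < d /\
    forall w, Cabs (Csub w z) < d -> Cabs (Csub (h w) (h z)) < eps.
Proof.
  split.
  - intros [h1 h2] eps he.
    destruct (proj1 (cont_eps _ _) h1 (eps / 2) ltac:(lra)) as [d1 [hd1 H1]].
    destruct (proj1 (cont_eps _ _) h2 (eps / 2) ltac:(lra)) as [d2 [hd2 H2]].
    exists (Rmin d1 d2); split; [now apply Rmin_pos|]; intros w hw.
    pose proof (Rmin_l d1 d2); pose proof (Rmin_r d1 d2).
    pose proof (Rabs_fst_le_Cabs (Csub w z)) as a1.
    pose proof (Rabs_snd_le_Cabs (Csub w z)) as a2.
    change (fst (Csub w z)) with (fst w - fst z) in a1.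
    change (snd (Csub w z)) with (snd w - snd z) in a2.
    specialize (H1 w ltac:(lra) ltac:(lra)); specialize (H2 w ltac:(lra) ltac:(lra)).
    pose proof (Cabs_le_Rabs (Csub (h w) (h z))) as a3.
    change (fst (Csub (h w) (h z))) with (fst (h w) - fst (h z)) in a3.
    change (snd (Csub (h w) (h z))) with (snd (h w) - snd (h z)) in a3.
    lra.
  - intros H; split; apply cont_eps; intros eps he; destruct (H eps he) as [d [hd Hd]];
      exists (d / 2); (split; [lra|]); intros w h1 h2.
    all: pose proof (Cabs_le_Rabs (Csub w z)) as a1;
      change (fst (Csub w z)) with (fst w - fst z) in a1;
      change (snd (Csub w z)) with (snd w - snd z) in a1;
      specialize (Hd w ltac:(lra)); eapply Rle_lt_trans; [|exact Hd].
    + apply (Rabs_fst_le_Cabs (Csub (h w) (h z))).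
    + apply (Rabs_snd_le_Cabs (Csub (h w) (h z))).
Qed.

Lemma CP1_cont_at_of_Ccont (f : CP1 -> CP1) (h : Cpx -> Cpx) (z : Cpx) :
  (forall w, f (Some w) = Some (h w)) -> Ccont h z -> CP1_cont_at f (Some z).
Proof.
  intros hf hh eps he.
  destruct (proj1 (Ccont_eps h z) hh (eps / 2) ltac:(lra)) as [d [hd Hd]].
  set (B := 1 + Cabs z); pose proof (Cabs_ge0 z).
  assert (hB : 1 <= B) by (unfold B; lra).
  (* The bound [/ B] excludes infinity and permits [Cabs_le_chordal], whose conclusion the second
     bound turns into a distance below [d]. *)
  exists (Rmin (/ B) (d / (B * B))); split.
  { apply Rmin_pos; [apply Rinv_0_lt_compat; lra | apply Rdiv_lt_0_compat; nra]. }
  intros y hy; pose proof (Rmin_l (/ B) (d / (B * B))); pose proof (Rmin_r (/ B) (d / (B * B))).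
  assert (h1 : chordal (Some z) y * B < 1).
  { replace 1 with (/ B * B) by (field; lra); apply Rmult_lt_compat_r; lra. }
  assert (h2 : chordal (Some z) y * (B * B) < d) by (apply Rlt_div_r; nra).
  destruct y as [w|].
  - rewrite !hf; eapply Rle_lt_trans; [apply chordal_le_Cabs|].
    assert (Cabs (Csub (h w) (h z)) < eps / 2); [|lra].
    apply Hd; eapply Rle_lt_trans; [apply Cabs_le_chordal; fold B; lra|].
    fold B; lra.
  - pose proof (chordal_None_ge z); fold B in H2; lra.
Qed.

Lemma Ccont_of_CP1_cont_at (f : CP1 -> CP1) (h : Cpx -> Cpx) (z : Cpx) :
  (forall w, w <> C0 -> f (Some w) = Some (h w)) -> z <> C0 ->
  CP1_cont_at f (Some z) -> Ccont h z.
Proof.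
  intros hf hz hc; apply Ccont_eps; intros eps he.
  set (B := 1 + Cabs (h z)); pose proof (Cabs_ge0 (h z)).
  assert (hB : 1 <= B) by (unfold B; lra).
  destruct (hc (Rmin (/ B) (eps / (B * B)))) as [d [hd Hd]].
  { apply Rmin_pos; [apply Rinv_0_lt_compat; lra | apply Rdiv_lt_0_compat; nra]. }
  pose proof (Cabs_gt0 z hz) as hz0.
  (* The radius [Cabs z] keeps [w] away from 0, where [f] may be infinite; the 2 is the factor in
     [chordal_le_Cabs]. *)
  exists (Rmin (d / 2) (Cabs z)); split; [apply Rmin_pos; lra|]; intros w hw.
  pose proof (Rmin_l (d / 2) (Cabs z)); pose proof (Rmin_r (d / 2) (Cabs z)).
  assert (hw0 : w <> C0).
  { intros ->; replace (Cabs (Csub C0 z)) with (Cabs z) in hw; [lra|].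
    unfold Cabs, Cnorm2, Csub, Cadd, Copp, C0; simpl; f_equal; ring. }
  specialize (Hd (Some w)); rewrite !hf in Hd by assumption.
  pose proof (chordal_le_Cabs z w); specialize (Hd ltac:(lra)).
  pose proof (Rmin_l (/ B) (eps / (B * B))); pose proof (Rmin_r (/ B) (eps / (B * B))).
  assert (h1 : chordal (Some (h z)) (Some (h w)) * B < 1).
  { replace 1 with (/ B * B) by (field; lra); apply Rmult_lt_compat_r; lra. }
  assert (h2 : chordal (Some (h z)) (Some (h w)) * (B * B) < eps) by (apply Rlt_div_r; nra).
  eapply Rle_lt_trans; [apply Cabs_le_chordal; fold B; lra|]; fold B; lra.
Qed.

(** * Restriction to the punctured plane *)

Lemma CP1_mul_fixed (l : Cpx) (x : CP1) :
  l <> C1 -> (CP1_mul l x = x <-> (x = None \/ x = Some C0)).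
Proof.
  intros hl; split.
  - destruct x as [z|]; [|now left]; intros H; right; injection H as H; f_equal.
    assert (E : Cmul (Csub l C1) z = C0).
    { transitivity (Csub (Cmul l z) z); [ring | rewrite H; ring]. }
    destruct (Cmul_eq0 _ _ E) as [h|h]; [|exact h].
    exfalso; apply hl; transitivity (Cadd (Csub l C1) C1); [ring | rewrite h; ring].
  - intros [->| ->]; simpl; [reflexivity | f_equal; ring].
Qed.

Lemma CP1_punctured_nz (x : CP1) :
  ~ (x = None \/ x = Some C0) -> exists z, z <> C0 /\ x = Some z.
Proof.
  destruct x as [z|]; intros h; [|exfalso; apply h; now left].
  exists z; split; [|reflexivity]; intros ->; apply h; now right.
Qed.

(** The default [C0] is not reached at nonzero [z] once [f] preserves the pair of 0 and infinity; at
    0 it may be, since [f] can exchange the two. *)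
Definition finite_part (f : CP1 -> CP1) (z : Cpx) : Cpx :=
  match f (Some z) with Some w => w | None => C0 end.

Lemma diag_equivariant_multipliers (I : Type) (f : CP1 -> CP1) (l m : I -> Cpx) :
  homeomorphism_CP1 f -> (forall r, l r <> C0) ->
  (forall r x, f (CP1_mul (l r) x) = CP1_mul (m r) (f x)) ->
  exists alpha, Re alpha <> -1 /\
    ((forall r, m r = Cmul (l r) (Rcpow (Cabs (l r)) alpha)) \/
     (forall r, m r = Cmul (Cconj (l r)) (Rcpow (Cabs (l r)) alpha))).
Proof.
  intros [g [gf [fg [cf cg]]]] hl hf.
  (* A multiplication is trivial as soon as it fixes a point other than 0 and infinity, and the
     bijection [f] transports triviality both ways. *)
  assert (hm1 : forall r, l r = C1 <-> m r = C1).
  { assert (h1 : forall a x, x <> None -> x <> Some C0 -> CP1_mul a x = x -> a = C1).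
    { intros a x x1 x2 H; apply NNPP; intros ha; apply (CP1_mul_fixed a x ha) in H.
      destruct H; contradiction. }
    intros r; split; intros H.
    - destruct (Ceq_dec (m r) C1) as [h|h]; [exact h|exfalso].
      assert (Hx : forall y, y = None \/ y = Some C0).
      { intros y; apply (CP1_mul_fixed (m r) y h).
        rewrite <- (fg y), <- hf, H, CP1_mul_1; reflexivity. }
      destruct (Hx (Some C1)) as [e|e]; [discriminate|]; injection e; lra.
    - apply (h1 _ (Some C1)); [discriminate | intros e; injection e; lra |].
      rewrite <- (gf (Some C1)) at 2; rewrite <- (CP1_mul_1 (f (Some C1))), <- H, <- hf, gf.
      reflexivity. }
  destruct (classic (exists r, l r <> C1)) as [[r0 hr0]|Hno].
  - assert (hm0 : m r0 <> C1) by (rewrite <- hm1; exact hr0).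
    (* [f] carries the fixed points of multiplication by [l r0] to those of multiplication by
       [m r0]; both sets consist of 0 and infinity. *)
    assert (Hfix : forall x, (x = None \/ x = Some C0) <-> (f x = None \/ f x = Some C0)).
    { intros x; rewrite <- (CP1_mul_fixed _ x hr0), <- (CP1_mul_fixed _ (f x) hm0), <- hf.
      split; [now intros ->|]; intros H; rewrite <- (gf (CP1_mul (l r0) x)), H; apply gf. }
    assert (Hf : forall z, z <> C0 -> finite_part f z <> C0 /\ f (Some z) = Some (finite_part f z)).
    { intros z hz; destruct (CP1_punctured_nz (f (Some z))) as [w [hw Ew]].
      - rewrite <- Hfix; intros [e|e]; [discriminate | injection e; exact hz].
      - unfold finite_part; rewrite Ew; now split. }
    assert (Hg : forall z, z <> C0 -> finite_part g z <> C0 /\ g (Some z) = Some (finite_part g z)).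
    { intros z hz; destruct (CP1_punctured_nz (g (Some z))) as [w [hw Ew]].
      - rewrite Hfix, fg; intros [e|e]; [discriminate | injection e; exact hz].
      - unfold finite_part; rewrite Ew; now split. }
    destruct (equivariant_multipliers (finite_part f) (finite_part g)) as [alpha [ha H]].
    + intros z hz; now apply Hf.
    + intros z hz; now apply Hg.
    + intros z hz; apply (Ccont_of_CP1_cont_at f); [|exact hz | exact (cf _)].
      intros w hw; now apply Hf.
    + intros z hz; apply (Ccont_of_CP1_cont_at g); [|exact hz | exact (cg _)].
      intros w hw; now apply Hg.
    + intros z hz; unfold finite_part at 1; rewrite <- (proj2 (Hf z hz)), gf; reflexivity.
    + intros z hz; unfold finite_part at 1; rewrite <- (proj2 (Hg z hz)), fg; reflexivity.
    + exists alpha; split; [exact ha|].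
      assert (He : forall r z, z <> C0 ->
        finite_part f (Cmul (l r) z) = Cmul (m r) (finite_part f z)).
      { intros r z hz; unfold finite_part at 1.
        change (Some (Cmul (l r) z)) with (CP1_mul (l r) (Some z)).
        rewrite hf, (proj2 (Hf z hz)); reflexivity. }
      destruct H as [H|H]; [left|right]; intros r; apply H; auto.
  - assert (Hl : forall r, l r = C1).
    { intros r; apply NNPP; intros h; apply Hno; now exists r. }
    (* All multipliers are 1 on both sides, so the exponent 0 will do. *)
    exists C0; split; [unfold Re, C0; simpl; lra|]; left; intros r.
    rewrite (proj1 (hm1 r) (Hl r)), (Hl r); unfold Rcpow.
    replace (Cmul C0 (RtoC (ln (Cabs C1)))) with C0 by ring.
    rewrite Cexp_0; ring.
Qed.

(** * Power maps of the sphere *)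

Definition Cpow_map (alpha z : Cpx) : Cpx :=
  if Ceq_dec z C0 then C0 else Cmul z (Rcpow (Cabs z) alpha).

(** In logarithmic coordinates the power map is real-linear, with a lower triangular matrix; the
    algebraic identities below reduce to this form. *)
Lemma Cpow_map_exp (alpha u : Cpx) :
  Cpow_map alpha (Cexp u) = Cexp ((1 + fst alpha) * fst u, snd u + snd alpha * fst u).
Proof.
  unfold Cpow_map; destruct (Ceq_dec (Cexp u) C0) as [h|_]; [now apply Cexp_neq0 in h|].
  rewrite Cabs_exp, Rcpow_exp, <- Cexp_add; f_equal.
  apply Cpx_ext; unfold Cadd, Cmul, RtoC; simpl; ring.
Qed.

Lemma Cpow_map_0 (alpha : Cpx) : Cpow_map alpha C0 = C0.
Proof. unfold Cpow_map; destruct (Ceq_dec C0 C0); [reflexivity | contradiction]. Qed.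

Lemma Cpow_map_neq0 (alpha z : Cpx) : z <> C0 -> Cpow_map alpha z <> C0.
Proof. intros h; destruct (Cexp_surj z h) as [u <-]; rewrite Cpow_map_exp; apply Cexp_neq0. Qed.

Lemma Ccont_Cpow_map (alpha z : Cpx) : -1 < fst alpha -> Ccont (Cpow_map alpha) z.
Proof.
  intros ha; destruct (Ceq_dec z C0) as [->|hz].
  - apply Ccont_eps; intros eps he; set (c := 1 + fst alpha).
    (* Since [|z |z|^alpha| = |z|^c], the radius is [eps^(1/c)]; this uses [c > 0]. *)
    exists (exp (ln eps / c)); split; [apply exp_pos|]; intros w hw.
    rewrite Cpow_map_0; replace (Csub (Cpow_map alpha w) C0) with (Cpow_map alpha w) by ring.
    replace (Csub w C0) with w in hw by ring.
    destruct (Ceq_dec w C0) as [->|h].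
    + rewrite Cpow_map_0; unfold Cabs; rewrite Cnorm2_C0, sqrt_0; exact he.
    + destruct (Cexp_surj w h) as [u <-]; rewrite Cpow_map_exp, Cabs_exp in *; simpl.
      apply exp_lt_inv in hw; rewrite <- (exp_ln eps) by exact he.
      apply exp_increasing; fold c; apply Rlt_div_r in hw; unfold c in *; lra.
  - set (k := fun w => Cmul w (Rcpow (Cabs w) alpha)).
    assert (hid : Ccont (fun w => w) z) by (split; [apply cont_fst | apply cont_snd]).
    assert (hln : cont (fun w => ln (Cabs w)) z).
    { apply (cont_comp ln); [now apply continuity_pt_ln, Cabs_gt0 | now apply cont_Cabs]. }
    assert (hexp : Ccont (fun w => Rcpow (Cabs w) alpha) z).
    { apply (Ccont_comp Cexp (fun w => Cmul alpha (RtoC (ln (Cabs w))))); [|apply Ccont_exp].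
      split; unfold Cmul, RtoC; simpl;
        [apply cont_minus | apply cont_plus]; apply cont_mult;
        try apply cont_const; exact hln. }
    assert (hk : Ccont k z).
    { destruct hid as [i1 i2]; destruct hexp as [e1 e2].
      split; unfold k, Cmul; simpl; [apply cont_minus | apply cont_plus];
        apply cont_mult; assumption. }
    pose proof (Cabs_gt0 z hz) as hz0.
    (* The box of half-width [|z| / 2] misses the origin because [|z|] is at most the sum of the
       absolute values of the coordinates. *)
    assert (Hloc : forall w, Rabs (fst w - fst z) < Cabs z / 2 ->
      Rabs (snd w - snd z) < Cabs z / 2 -> k w = Cpow_map alpha w).
    { intros w h1 h2; unfold Cpow_map; destruct (Ceq_dec w C0) as [->|_]; [exfalso|reflexivity].
      unfold C0 in h1, h2; simpl in h1, h2; rewrite Rminus_0_l, Rabs_Ropp in h1, h2.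
      pose proof (Cabs_le_Rabs z); lra. }
    split.
    + apply (cont_ext_loc (fun w => fst (k w)) _ z (Cabs z / 2)); [lra| |apply hk].
      intros w h1 h2; now rewrite Hloc.
    + apply (cont_ext_loc (fun w => snd (k w)) _ z (Cabs z / 2)); [lra| |apply hk].
      intros w h1 h2; now rewrite Hloc.
Qed.

Definition CP1_pow (alpha : Cpx) (x : CP1) : CP1 := option_map (Cpow_map alpha) x.

Definition CP1_inv (x : CP1) : CP1 :=
  match x with
  | Some z => if Ceq_dec z C0 then None else Some (Cinv z)
  | None => Some C0
  end.

Definition CP1_conj (x : CP1) : CP1 := option_map Cconj x.

Definition swap_mat : mat2 := ((C0, C1), (C1, C0)).

Lemma mdet_swap : mdet swap_mat <> C0.
Proof. unfold mdet, swap_mat; simpl; intros H; injection H; simpl; lra. Qed.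

(** Presents inversion as a Moebius transformation, so that its continuity comes from
    [homeomorphism_CP1_pact]. *)
Lemma pact_swap (x : CP1) : pact swap_mat x = CP1_inv x.
Proof.
  unfold pact, swap_mat, m11, m12, m21, m22, CP1_inv; destruct x as [z|]; cbn [fst snd].
  - replace (Cadd (Cmul C1 z) C0) with z by ring.
    destruct (Ceq_dec z C0) as [h|h]; [reflexivity|]; f_equal; field; exact h.
  - destruct (Ceq_dec C1 C0) as [h|h]; [now apply C1_neq0 in h|]; f_equal; field; exact h.
Qed.

Lemma homeomorphism_CP1_ext (f g : CP1 -> CP1) :
  (forall x, f x = g x) -> homeomorphism_CP1 f -> homeomorphism_CP1 g.
Proof.
  intros E [f' [h1 [h2 [h3 h4]]]]; exists f'; repeat split.
  - intros x; now rewrite <- E.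
  - intros x; now rewrite <- E.
  - intros x eps he; destruct (h3 x eps he) as [d [hd Hd]]; exists d; split; [exact hd|].
    intros y hy; rewrite <- !E; now apply Hd.
  - exact h4.
Qed.

Lemma homeomorphism_CP1_inv : homeomorphism_CP1 CP1_inv.
Proof.
  apply (homeomorphism_CP1_ext (pact swap_mat)); [exact pact_swap|].
  apply homeomorphism_CP1_pact, mdet_swap.
Qed.

Lemma CP1_invK (x : CP1) : CP1_inv (CP1_inv x) = x.
Proof.
  destruct x as [z|]; cbn [CP1_inv].
  - destruct (Ceq_dec z C0) as [->|h]; [reflexivity|]; cbn [CP1_inv].
    destruct (Ceq_dec (Cinv z) C0) as [h'|_]; [now apply Cinv_neq0 in h'|].
    f_equal; field; split; [exact h | apply C1_neq0].
  - destruct (Ceq_dec C0 C0); [reflexivity | contradiction].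
Qed.

Lemma homeomorphism_CP1_conj : homeomorphism_CP1 CP1_conj.
Proof.
  assert (hK : forall x, CP1_conj (CP1_conj x) = x).
  { intros [z|]; simpl; [|reflexivity]; f_equal; destruct z; unfold Cconj; simpl.
    now rewrite Ropp_involutive. }
  assert (hc : continuous_CP1 CP1_conj).
  { apply continuous_CP1_lipschitz with (K := 1); intros x y.
    replace (chordal (CP1_conj x) (CP1_conj y)) with (chordal x y); [lra|].
    assert (hn : forall z, Cnorm2 (Cconj z) = Cnorm2 z)
      by (intros z; unfold Cnorm2, Cconj; simpl; ring).
    destruct x as [z|], y as [w|]; simpl; rewrite ?hn; try reflexivity.
    do 2 f_equal; unfold Cabs; f_equal; unfold Cnorm2, Csub, Cadd, Copp, Cconj; simpl; ring. }
  exists CP1_conj; repeat split; assumption.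
Qed.

Lemma Cinv_exp (u : Cpx) : Cinv (Cexp u) = Cexp (Copp u).
Proof.
  pose proof (Cexp_neq0 u) as h.
  replace (Cexp (Copp u)) with (Cdiv (Cmul (Cexp (Copp u)) (Cexp u)) (Cexp u))
    by (field; exact h).
  rewrite <- Cexp_add; replace (Cadd (Copp u) u) with C0 by ring.
  rewrite Cexp_0; field; exact h.
Qed.

(** Inversion is [u |-> - u] in logarithmic coordinates and commutes with every linear map; this
    transfers continuity from 0 to infinity. *)
Lemma CP1_pow_inv (alpha : Cpx) (x : CP1) :
  CP1_pow alpha (CP1_inv x) = CP1_inv (CP1_pow alpha x).
Proof.
  destruct x as [z|]; simpl; [|now rewrite Cpow_map_0].
  destruct (Ceq_dec z C0) as [->|h].
  - rewrite Cpow_map_0; destruct (Ceq_dec C0 C0); [reflexivity | contradiction].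
  - destruct (Ceq_dec (Cpow_map alpha z) C0) as [h'|_]; [now apply Cpow_map_neq0 in h'|].
    destruct (Cexp_surj z h) as [u <-]; simpl; f_equal.
    rewrite Cinv_exp, !Cpow_map_exp, Cinv_exp; f_equal.
    apply Cpx_ext; unfold Copp; simpl; ring.
Qed.

Lemma continuous_CP1_pow (alpha : Cpx) : -1 < fst alpha -> continuous_CP1 (CP1_pow alpha).
Proof.
  intros ha; assert (hf : forall z, CP1_cont_at (CP1_pow alpha) (Some z)).
  { intros z; apply (CP1_cont_at_of_Ccont _ (Cpow_map alpha)); [reflexivity|].
    now apply Ccont_Cpow_map. }
  destruct homeomorphism_CP1_inv as [_ [_ [_ [hi _]]]].
  intros [z|]; [apply hf|].
  (* Conjugated by inversion, the power map is continuous at infinity because it is so at 0; by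
     [CP1_pow_inv] the conjugate is the map itself. *)
  assert (H : CP1_cont_at (fun x => CP1_inv (CP1_pow alpha (CP1_inv x))) None).
  { apply (CP1_cont_at_comp (fun x => CP1_pow alpha (CP1_inv x)) CP1_inv).
    - apply (CP1_cont_at_comp CP1_inv (CP1_pow alpha)); [exact (hi _) | apply hf].
    - exact (hi _). }
  intros eps he; destruct (H eps he) as [d [hd Hd]]; exists d; split; [exact hd|].
  intros y hy; specialize (Hd y hy); rewrite !CP1_pow_inv, !CP1_invK in Hd; exact Hd.
Qed.

(** The two conditions say that the triangular matrices of [Cpow_map_exp] multiply to the
    identity. *)
Lemma CP1_pow_comp_id (alpha beta : Cpx) (x : CP1) :
  (1 + fst alpha) * (1 + fst beta) = 1 ->
  snd alpha + snd beta * (1 + fst alpha) = 0 ->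
  CP1_pow beta (CP1_pow alpha x) = x.
Proof.
  intros h1 h2; destruct x as [z|]; simpl; [|reflexivity]; f_equal.
  destruct (Ceq_dec z C0) as [->|h]; [now rewrite !Cpow_map_0|].
  destruct (Cexp_surj z h) as [u <-]; rewrite !Cpow_map_exp; f_equal.
  apply Cpx_ext; simpl.
  - transitivity ((1 + fst alpha) * (1 + fst beta) * fst u); [ring | rewrite h1; ring].
  - transitivity (snd u + (snd alpha + snd beta * (1 + fst alpha)) * fst u);
      [ring | rewrite h2; ring].
Qed.

Lemma homeomorphism_CP1_pow (alpha : Cpx) :
  -1 < fst alpha -> homeomorphism_CP1 (CP1_pow alpha).
Proof.
  intros ha; set (c := 1 + fst alpha).
  exists (CP1_pow (/ c - 1, - snd alpha / c)); repeat split.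
  - intros x; apply CP1_pow_comp_id; simpl; fold c; field; unfold c; lra.
  - intros x; apply CP1_pow_comp_id; simpl; fold c; field; unfold c; lra.
  - now apply continuous_CP1_pow.
  - apply continuous_CP1_pow; simpl.
    assert (0 < / c) by (apply Rinv_0_lt_compat; unfold c; lra); lra.
Qed.

Lemma CP1_pow_mul (alpha l : Cpx) (x : CP1) :
  l <> C0 ->
  CP1_pow alpha (CP1_mul l x) = CP1_mul (Cmul l (Rcpow (Cabs l) alpha)) (CP1_pow alpha x).
Proof.
  intros hl; destruct x as [z|]; simpl; [|reflexivity]; f_equal.
  destruct (Ceq_dec z C0) as [->|h].
  - replace (Cmul l C0) with C0 by ring; rewrite !Cpow_map_0; ring.
  - destruct (Cexp_surj z h) as [u <-]; destruct (Cexp_surj l hl) as [v <-].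
    rewrite <- Cexp_add, !Cpow_map_exp, Cabs_exp, Rcpow_exp, <- !Cexp_add; f_equal.
    apply Cpx_ext; unfold Cadd, Cmul, RtoC; simpl; ring.
Qed.

Lemma CP1_inv_mul (l : Cpx) (x : CP1) :
  l <> C0 -> CP1_inv (CP1_mul l x) = CP1_mul (Cinv l) (CP1_inv x).
Proof.
  intros hl; destruct x as [z|]; cbn [CP1_inv CP1_mul option_map]; [|f_equal; ring].
  destruct (Ceq_dec z C0) as [->|h].
  - destruct (Ceq_dec (Cmul l C0) C0) as [_|H]; [reflexivity | exfalso; apply H; ring].
  - destruct (Ceq_dec (Cmul l z) C0) as [H|_]; [now apply Cmul_neq0 in H|].
    cbn [CP1_mul option_map]; f_equal; field; now split.
Qed.

Lemma CP1_conj_mul (l : Cpx) (x : CP1) :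
  CP1_conj (CP1_mul l x) = CP1_mul (Cconj l) (CP1_conj x).
Proof.
  destruct x as [z|]; simpl; [|reflexivity]; f_equal.
  apply Cpx_ext; unfold Cconj, Cmul; simpl; ring.
Qed.

Lemma Cconj_neq0 (z : Cpx) : z <> C0 -> Cconj z <> C0.
Proof.
  intros h H; apply h; unfold Cconj, C0 in *; injection H; intros h1 h2.
  apply Cpx_ext; simpl; lra.
Qed.

Lemma Cabs_conj (z : Cpx) : Cabs (Cconj z) = Cabs z.
Proof. unfold Cabs, Cnorm2, Cconj; simpl; f_equal; ring. Qed.

Lemma Rcpow_neq0 (t : R) (alpha : Cpx) : Rcpow t alpha <> C0.
Proof. apply Cexp_neq0. Qed.

(** The exponent [-2 - alpha]: as [1 / z] is the conjugate of [z] times [|z|^(-2)], inverting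
    [z |z|^(-2 - alpha)] gives the conjugate of [z] times [|z|^alpha]. It reflects [Re alpha] in
    -1. *)
Definition flip_exponent (alpha : Cpx) : Cpx := (-2 - fst alpha, - snd alpha).

Lemma Cinv_mul_Rcpow_flip (l alpha : Cpx) :
  l <> C0 ->
  Cinv (Cmul l (Rcpow (Cabs l) (flip_exponent alpha))) =
  Cmul (Cconj l) (Rcpow (Cabs l) alpha).
Proof.
  intros h; destruct (Cexp_surj l h) as [u <-].
  rewrite Cabs_exp, !Rcpow_exp, Cconj_exp, <- !Cexp_add, Cinv_exp; f_equal.
  apply Cpx_ext; unfold Copp, Cadd, Cmul, RtoC, Cconj, flip_exponent; simpl; ring.
Qed.

(* For Re alpha < -1 the map z |z|^alpha exchanges 0 and infinity; it is obtained from the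
   exponent -2 - alpha by composing with z |-> 1 / z and conjugation. *)
Lemma equivariant_homeomorphism (I : Type) (l m : I -> Cpx) (alpha : Cpx) :
  (forall r, l r <> C0) -> Re alpha <> -1 ->
  ((forall r, m r = Cmul (l r) (Rcpow (Cabs (l r)) alpha)) \/
   (forall r, m r = Cmul (Cconj (l r)) (Rcpow (Cabs (l r)) alpha))) ->
  exists f, homeomorphism_CP1 f /\ forall r x, f (CP1_mul (l r) x) = CP1_mul (m r) (f x).
Proof.
  intros hl ha H; unfold Re in ha.
  destruct (Rlt_or_le (-1) (fst alpha)) as [h|h].
  - pose proof (homeomorphism_CP1_pow alpha h) as hp; destruct H as [H|H].
    + exists (CP1_pow alpha); split; [exact hp|]; intros r x.
      now rewrite CP1_pow_mul, H.
    + exists (fun x => CP1_pow alpha (CP1_conj x)); split.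
      * apply homeomorphism_CP1_comp; [apply homeomorphism_CP1_conj | exact hp].
      * intros r x; rewrite CP1_conj_mul, CP1_pow_mul, H, Cabs_conj; [reflexivity|].
        now apply Cconj_neq0.
  - assert (hp : homeomorphism_CP1 (fun x => CP1_inv (CP1_pow (flip_exponent alpha) x))).
    { apply (homeomorphism_CP1_comp (CP1_pow (flip_exponent alpha)) CP1_inv);
        [|apply homeomorphism_CP1_inv].
      apply homeomorphism_CP1_pow; unfold flip_exponent; simpl; lra. }
    assert (he : forall k x, k <> C0 ->
      CP1_inv (CP1_pow (flip_exponent alpha) (CP1_mul k x)) =
      CP1_mul (Cmul (Cconj k) (Rcpow (Cabs k) alpha))
        (CP1_inv (CP1_pow (flip_exponent alpha) x))).
    { intros k x hk; rewrite CP1_pow_mul, CP1_inv_mul, Cinv_mul_Rcpow_flip; try exact hk.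
      - reflexivity.
      - apply Cmul_neq0; [exact hk | apply Rcpow_neq0]. }
    (* Inversion has already introduced a conjugation, so here the alternative without conjugation
       is the one that needs [CP1_conj]. *)
    destruct H as [H|H].
    + exists (fun x => CP1_inv (CP1_pow (flip_exponent alpha) (CP1_conj x))); split.
      * apply (homeomorphism_CP1_comp CP1_conj
          (fun x => CP1_inv (CP1_pow (flip_exponent alpha) x)));
          [apply homeomorphism_CP1_conj | exact hp].
      * intros r x; rewrite CP1_conj_mul, he, H, Cabs_conj by now apply Cconj_neq0.
        do 2 f_equal; destruct (l r); unfold Cconj; simpl; now rewrite Ropp_involutive.
    + exists (fun x => CP1_inv (CP1_pow (flip_exponent alpha) x)); split; [exact hp|].
      intros r x; now rewrite he, H.
Qed.

(** * Return from the diagonal forms to the given matrices *)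

Lemma Cconj_div (z w : Cpx) : w <> C0 -> Cdiv (Cconj z) (Cconj w) = Cconj (Cdiv z w).
Proof.
  intros h; pose proof (Cnorm2_gt0 w h) as hn; unfold Cnorm2 in hn.
  apply Cpx_ext; unfold Cdiv, Cconj, Cinv, Cmul, Cnorm2; simpl; field; nra.
Qed.

Theorem theorem6p1 (I : Type) (S T : mat2) (p1 p2 q1 q2 : I -> Cpx)
  (hS : mdet S <> C0) (hT : mdet T <> C0)
  (hp1 : forall r, p1 r <> C0) (hp2 : forall r, p2 r <> C0)
  (hq1 : forall r, q1 r <> C0) (hq2 : forall r, q2 r <> C0) :
  let P := fun r => mmul S (mmul (diag2 (p1 r) (p2 r)) (minv S)) in
  let Q := fun r => mmul T (mmul (diag2 (q1 r) (q2 r)) (minv T)) in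
  (exists f : CP1 -> CP1, homeomorphism_CP1 f /\
     forall (r : I) (v : CP1), f (pact (P r) v) = pact (Q r) (f v))
  <->
  (exists alpha : Cpx, Re alpha <> -1 /\
     ((forall r, Cdiv (q1 r) (q2 r) =
                 Cmul (Cdiv (p1 r) (p2 r)) (Rcpow (Cabs (Cdiv (p1 r) (p2 r))) alpha))
      \/
      (forall r, Cdiv (q1 r) (q2 r) =
                 Cmul (Cdiv (Cconj (p1 r)) (Cconj (p2 r)))
                      (Rcpow (Cabs (Cdiv (p1 r) (p2 r))) alpha)))).
Proof.
  intros P Q.
  set (l := fun r => Cdiv (p1 r) (p2 r)); set (m := fun r => Cdiv (q1 r) (q2 r)).
  assert (hl : forall r, l r <> C0) by (intros r; now apply Cdiv_neq0).
  assert (HP : forall r x, pact (P r) x = pact S (CP1_mul (l r) (pact (minv S) x)))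
    by (intros r x; now apply pact_conj_diag).
  assert (HQ : forall r x, pact (Q r) x = pact T (CP1_mul (m r) (pact (minv T) x)))
    by (intros r x; now apply pact_conj_diag).
  split.
  - intros [f [hf Hf]].
    (* In eigenvector coordinates [f] becomes [T^(-1) f S], which intertwines the multiplications by
       [l r] and [m r]. *)
    destruct (diag_equivariant_multipliers I (fun x => pact (minv T) (f (pact S x))) l m)
      as [alpha [ha H]]; [| exact hl | |].
    + apply (homeomorphism_CP1_comp (fun x => f (pact S x)) (pact (minv T))).
      * apply (homeomorphism_CP1_comp (pact S) f); [now apply homeomorphism_CP1_pact | exact hf].
      * now apply homeomorphism_CP1_pact, mdet_minv.
    + intros r x; rewrite <- (pact_minv_l S x hS) at 1.
      rewrite <- HP, Hf, HQ; now apply pact_minv_l.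
    + exists alpha; split; [exact ha|].
      destruct H as [H|H]; [left|right]; intros r; [apply H|].
      rewrite Cconj_div by apply hp2; apply H.
  - intros [alpha [ha H]].
    destruct (equivariant_homeomorphism I l m alpha hl ha) as [f [hf Hf]].
    + destruct H as [H|H]; [left|right]; intros r; [apply H|].
      unfold m, l; rewrite H, Cconj_div by apply hp2; reflexivity.
    + exists (fun x => pact T (f (pact (minv S) x))); split.
      * apply (homeomorphism_CP1_comp (fun x => f (pact (minv S) x)) (pact T)).
        -- apply (homeomorphism_CP1_comp (pact (minv S)) f);
             [now apply homeomorphism_CP1_pact, mdet_minv | exact hf].
        -- now apply homeomorphism_CP1_pact.
      * intros r x; rewrite HP, HQ, !pact_minv_l by assumption; now rewrite Hf.
Qed.
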